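(* Let $\mathbb{H}$ be an infinite-dimensional separable real Hilbert space and let $y_1,\dots,y_n$ be $n$ independent realizations of an $\mathbb{H}$-valued Gaussian random element with mean zero and covariance operator $C=\sum_{j\ge1}\lambda_j\,\psi_j\otimes\psi_j$. Let $\hat C=\frac1n\sum_{i=1}^n y_i\otimes y_i$. Then, as $\sigma\to\infty$, the maximum kernel mean (MKM) estimator of $\{\lambda_j,\psi_j\}_{j\ge1}$ converges to the system given, for each $k$, by 1. $\hat\psi_k=$ the $k$-th eigenfunction of $\hat C$; 2. $\hat\lambda_k=\frac1n\sum_{i=1}^n\langle y_i,\hat\psi_k\rangle^2$.
   Context: An $\mathbb{H}$-valued random element $Z$ is Gaussian with mean $\mu$ and covariance operator $C$, written $Z\sim\mathcal{N}(\mu,C)$, if $\langle a,Z\rangle\sim N(\langle a,\mu\rangle,\langle Ca,a\rangle)$ for all $a\in\mathbb{H}$; $C$ is then self-adjoint, nonnegative and trace class. Here $(\lambda_j,\psi_j)_{j\ge1}$ is the eigensystem of $C$ ($\psi_j$ orthonormal, $\lambda_j\ge 0$ in non-increasing order), $u\otimes u$ denotes the operator $v\mapsto\langle u,v\rangle u$, and the eigenfunctions of $\hat C$ are ordered by decreasing eigenvalue (eigenfunctions being determined only up to the usual indeterminacy of sign and of basis within eigenspaces). For $\sigma>0$, the MKM estimator of $\{\lambda_j,\psi_j\}_{j\ge1}$ is the eigensystem maximizing the logarithm of the kernel mean function of $\bigotimes_{i=1}^n\mathcal{N}(0,C)$ for the Gaussian product-kernel $\prod_{i=1}^n e^{-\sigma\|y_i-z_i\|_{\mathbb{H}}^2}$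 on $\mathbb{H}^n$, evaluated at the data: $$\log\int_{\mathbb{H}^n}e^{-\sigma\sum_{i=1}^n\|y_i-z_i\|_{\mathbb{H}}^2}\bigotimes_{i=1}^n\mathcal{N}(0,C)(dz_i)=\sum_{i=1}^n\sum_{j\ge1}\frac{-\sigma}{1+2\sigma\lambda_j}\langle y_i,\psi_j\rangle^2-\frac n2\sum_{j\ge1}\log(1+2\sigma\lambda_j).$$ *)

(* Defs.v *)
From HB Require Import structures.
From mathcomp Require Import all_boot all_order all_algebra sesquilinear.
From mathcomp Require Import all_classical all_reals all_analysis.

Set Implicit Arguments.
Unset Strict Implicit.
Unset Printing Implicit Defensive.
Import Order.TTheory GRing.Theory Num.Theory.
Import numFieldNormedType.Exports.

Local Open Scope classical_set_scope.
Local Open Scope ring_scope.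

(** Real Hilbert spaces: a complete normed module together with a positive
    definite symmetric form inducing its norm. *)
Definition induces_norm (R : realType) (H : completeNormedModType R)
    (ip : {dot H for idfun}) : Prop :=
  forall x : H, ip x x = `|x| ^+ 2.

Definition separable_space (T : topologicalType) : Prop :=
  exists2 D : set T, countable D & dense D.

Definition infinite_dimensional (R : realType) (H : lmodType R) : Prop :=
  ~ exists (n : nat) (e : 'I_n -> H),
      forall x : H, exists c : 'I_n -> R, x = \sum_(i < n) c i *: e i.

Notation borel T := (g_sigma_algebraType (@open T)).

Section power_measure.
Context d (T : measurableType d) (R : realType).

Definition tuple_cons n (x : T * n.-tuple T) : n.+1.-tuple T :=
  [tuple of x.1 :: x.2].

Lemma measurable_tuple_cons n : measurable_fun [set: T * n.-tuple T] (@tuple_cons n).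
Proof. exact: measurable_cons. Qed.

HB.instance Definition _ n := isMeasurableFun.Build _ _ _ _ (@tuple_cons n)
  (@measurable_tuple_cons n).

Fixpoint power_measure (mu : probability T R) (n : nat) :
    probability (n.-tuple T) R :=
  match n with
  | 0 => \d_([tuple] : 0.-tuple T)
  | m.+1 => distribution (mu \x power_measure mu m)%E (@tuple_cons m)
  end.

End power_measure.

Definition independent_elements d d' (Omega : measurableType d)
    (T : measurableType d') (R : realType) (P : probability Omega R)
    (n : nat) (Y : 'I_n -> {RV P >-> T}) : Prop :=
  forall (J : {set 'I_n}) (A : 'I_n -> set T),
    (forall i, measurable (A i)) ->
    P (\bigcap_(i in [set` J]) (Y i @^-1` A i)) =
    (\prod_(i in J) P (Y i @^-1` A i))%E.

(** [N(m, v)] on the line, for [0 <= v]; [normal_prob] takes the standard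
    deviation and is not the point mass when that is [0]. *)
Definition normal_law (R : realType) (m v : R) (A : set R) : \bar R :=
  if v == 0 then \d_m A else normal_prob m (Num.sqrt v) A.

Section hilbert.
Context (R : realType) (H : completeNormedModType R) (ip : {dot H for idfun}).

Definition gaussian (m : H) (C : H -> H) (mu : probability (borel H) R) : Prop :=
  forall a : H, 0 <= ip (C a) a /\
    forall A : set R, measurable A ->
      pushforward mu (fun z : borel H => ip a z) A =
      normal_law (ip a m) (ip (C a) a) A.

Definition tensor (u v w : H) : H := ip u w *: v.

(** [C = \sum_j lam j (psi j (x) psi j)] strongly. The system [psi] need not be
    complete, but every nonzero eigenvalue of [C] is listed, with its
    multiplicity. *)
Definition eigensystem (C : H -> H) (lam : nat -> R) (psi : nat -> H) : Prop :=
  [/\ forall i j, ip (psi i) (psi j) = (i == j)%:R,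
      forall j, 0 <= lam j,
      forall i j, (i <= j)%N -> lam j <= lam i &
      forall v, series (fun j => lam j *: tensor (psi j) (psi j) v) @ \oo --> C v].

Definition empirical_covariance n (y : 'I_n -> H) (v : H) : H :=
  n%:R^-1 *: \sum_(i < n) tensor (y i) (y i) v.

Definition kernel_mean n (sigma : R) (mu : probability (borel H) R)
    (y : 'I_n -> H) : R :=
  \int[power_measure mu n]_z
    expR (- sigma * \sum_(i < n) `|y i - (tnth z i : H)| ^+ 2).

(** The law [mu = N(0, C)] on the Borel sets is determined by [C] when [H] is
    separable; trace-classness of [C] is forced by the existence of [mu]. *)
Definition is_mkm n (sigma : R) (y : 'I_n -> H)
    (lam : nat -> R) (psi : nat -> H) : Prop :=
  exists (C : H -> H) (mu : probability (borel H) R),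
    [/\ eigensystem C lam psi, gaussian 0 C mu &
        forall (lam' : nat -> R) (psi' : nat -> H) (C' : H -> H)
            (mu' : probability (borel H) R),
          eigensystem C' lam' psi' -> gaussian 0 C' mu' ->
          ln (kernel_mean sigma mu' y) <= ln (kernel_mean sigma mu y)].

(** [psi] and [psi'] differ only by the indeterminacy (sign, basis within each
    eigenspace) of the eigenfunctions of one operator with eigenvalues [lam];
    [(lam, psi)] and [(lam, psi')] are then MKM estimators simultaneously. *)
Definition same_operator (lam : nat -> R) (psi psi' : nat -> H) : Prop :=
  exists C : H -> H, eigensystem C lam psi /\ eigensystem C lam psi'.

End hilbert.

(* Main.v *)
(** For a centred Gaussian law, [expR (- sigma * x ^+ 2)] is a mixture of cosines,
    so Fubini and the characteristic function factorize the kernel integral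
    along any family of directions that is orthogonal for the covariance.
    Truncating to [psi_0, ..., psi_(m-1)] and the direction of the residual
    bounds the kernel mean of [N(0, C)] from above, with equality for a
    finite-rank covariance whose range contains the data.

    Let [c_k, e_k] be the eigensystem of the empirical covariance.  The bound on
    [- ln / n] is, up to an error vanishing with [lam_m], a nonnegative
    combination, with the doubly substochastic weights [<psi_j, e_k> ^ 2], of the
    one-dimensional objectives
    [sigma * c_k / (1 + 2 * sigma * a) + ln (1 + 2 * sigma * a) / 2] at
    [a = lam_j]; each of these has the unique minimizer
    [a = max (0, c_k - 1 / (2 * sigma))].  Hence for every [sigma] the MKM
    covariance is exactly the soft-thresholded empirical covariance: its
    eigenvalues tend to [c_k], and its eigenfunctions may be taken to be [e_k]
    whatever [sigma] is. *)
Require Import Defs.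
From HB Require Import structures.
From mathcomp Require Import all_boot all_order all_algebra sesquilinear.
From mathcomp Require Import all_classical all_reals all_analysis.
From mathcomp Require Import measurable_realfun ring lra.
Import Order.TTheory GRing.Theory Num.Theory.
Import numFieldNormedType.Exports.
Set Implicit Arguments.
Unset Strict Implicit.
Unset Printing Implicit Defensive.
Local Open Scope classical_set_scope.
Local Open Scope ring_scope.

(** * The one-dimensional normal law *)

(** [gaussian] prescribes only the laws of the functionals [ip a z]: joint laws, densities and
    independence of coordinates are not given. Cosines get around this. A product of cosines of
    functionals is a sum of cosines of single functionals, whose integrals are known, and vanishing
    cross covariances then produce the factorization.

    A competing covariance may have infinite rank, and its [psi] need be neither complete nor
    aligned with the [e_k], so mass can be missing on both sides. The part of [psi_j] outside the
    span of the data carries no observation and costs [ln (1 + 2 * sigma * lam_j) / 2]. The part of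
    [e_k] missed by [psi_0, ..., psi_(m-1)] is charged the objective at [lam_m], and [lam_m] tends
    to 0 because a Gaussian measure with this covariance exists. Both charges exceed the optimum by
    a nonnegative amount, so nothing has to be known about [psi] in advance. Uniqueness of the
    one-dimensional minimizer turns a vanishing gap into equations that determine the operator. *)

Section bounded_functions.
Context d (T : measurableType d) {R : realType}.

Lemma bounded_integrable (P : probability T R) (f : T -> R) (M : R) :
  measurable_fun setT f -> (forall x, `|f x| <= M) ->
  P.-integrable setT (EFin \o f).
Proof.
move=> mf fM.
apply: le_integrable (finite_measure_integrable_cst P M measurableT) => //.
  exact/measurable_EFinP.
by move=> x _ /=; rewrite lee_fin (le_trans (fM x))// ler_norm.
Qed.

End bounded_functions.

Section normal_line.
Context {R : realType}.
Local Notation leb := (@lebesgue_measure R).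

(** The Radon-Nikodym derivative of [normal_prob] and [normal_pdf] have the same integral over every
    measurable set, hence agree almost everywhere. *)
Lemma integral_normal_prob (m s : R) f :
  (normal_prob m s).-integrable [set: R] f ->
  (\int[normal_prob m s]_x f x =
   \int[leb]_x (f x * (normal_pdf m s x)%:E))%E.
Proof.
move=> intf.
have dom := normal_prob_dominates m s.
have mp : measurable_fun setT (fun x : measurableTypeR R => (normal_pdf m s x)%:E).
  by apply/measurable_EFinP; exact: measurable_normal_pdf.
rewrite -(Radon_Nikodym_change_of_variables dom)//.
apply: ae_eq_integral => //.
- apply: emeasurable_funM; first exact: measurable_int intf.
  by apply: (measurable_int leb); exact: Radon_Nikodym_integrable.
- exact: emeasurable_funM (measurable_int _ intf) mp.
apply: ae_eqe_mul2l; apply: integral_ae_eq => //.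
  exact: Radon_Nikodym_integrable.
by move=> A _ mA; rewrite -Radon_Nikodym_integral.
Qed.

(** Packages the image of Lebesgue measure as a measure, the form in which it can be scaled and
    compared with Lebesgue measure by uniqueness. *)
Lemma lebesgue_affine_measure (b c : R) :
  exists nu : {measure set (measurableTypeR R) -> \bar R},
    forall B, nu B = leb ((fun x => (c + b * x)%R) @^-1` B).
Proof.
have mphi : measurable_fun setT
    (fun x : measurableTypeR R => c + b * x : measurableTypeR R).
  by apply: measurable_funD => //; apply: measurable_funM.
pose phi : {mfun measurableTypeR R >-> measurableTypeR R} :=
  HB.pack (fun x : measurableTypeR R => c + b * x : measurableTypeR R)
    (isMeasurableFun.Build _ _ _ _ _ mphi).
exists (measure_function_pushforward__canonical__measure_function_Measure leb mphi).
by [].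
Qed.

(** By uniqueness of Lebesgue measure it suffices to treat half-open intervals; a negative [b]
    reverses them, which exchanges the open and the closed end. *)
Lemma lebesgue_affine (b c : R) (A : set R) : b != 0 -> measurable A ->
  leb A = (`|b|%:E * leb ((fun x => (c + b * x)%R) @^-1` A))%E.
Proof.
move=> b0 mA.
have mphi : measurable_fun setT
    (fun x : measurableTypeR R => c + b * x : measurableTypeR R).
  by apply: measurable_funD => //; apply: measurable_funM.
have b0' : 0 <= `|b| by [].
have [nu nuE] : exists nu : {measure set (measurableTypeR R) -> \bar R},
    forall B, nu B = (`|b|%:E * leb ((fun x => (c + b * x)%R) @^-1` B))%E.
  by have [nu nuE] := lebesgue_affine_measure b c;
    exists (mscale (NngNum b0') nu) => B; rewrite -nuE.
rewrite -nuE; apply: lebesgue_measure_unique => //= _ [[l u]] _ <-.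
rewrite nuE lebesgue_measure_itv/=.
have [bneg|bpos|bE] := ltgtP b 0; last by rewrite bE eqxx in b0.
- have -> : (fun x : R => c + b * x) @^-1` `]l, u] = `[(u - c) / b, (l - c) / b[%classic.
    apply/seteqP; split => x /=; rewrite !in_itv/= ler_ndivrMr// ltr_ndivlMr//; lra.
  rewrite lebesgue_measure_itv/= !lte_fin.
  rewrite ltr_ndivrMr// divfK ?lt_eqF// ltrD2r ltr0_norm//.
  case: ifPn => lu; last by rewrite mule0.
  by rewrite -!EFinB -EFinM; congr EFin; field; rewrite lt_eqF.
- have -> : (fun x : R => c + b * x) @^-1` `]l, u] = `](l - c) / b, (u - c) / b]%classic.
    apply/seteqP; split => x /=; rewrite !in_itv/= ler_pdivlMr// ltr_pdivrMr//; lra.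
  rewrite lebesgue_measure_itv/= !lte_fin.
  rewrite ltr_pdivrMr// divfK ?gt_eqF// ltrD2r gtr0_norm//.
  case: ifPn => lu; last by rewrite mule0.
  by rewrite -!EFinB -EFinM; congr EFin; field; rewrite gt_eqF.
Qed.

Lemma ge0_integral_affine (b c : R) (f : R -> \bar R) : b != 0 ->
  measurable_fun setT f -> (forall x, 0 <= f x)%E ->
  (\int[leb]_x f x = `|b|%:E * \int[leb]_x f (c + b * x)%R)%E.
Proof.
move=> b0 mf f0.
have mphi : measurable_fun setT
    (fun x : measurableTypeR R => c + b * x : measurableTypeR R).
  by apply: measurable_funD => //; apply: measurable_funM.
have b0' : 0 <= `|b| by [].
have [nu nuE] : exists nu : {measure set (measurableTypeR R) -> \bar R},
    forall B, nu B = leb ((fun x => (c + b * x)%R) @^-1` B).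
  exact: lebesgue_affine_measure.
rewrite (eq_measure_integral (mscale (NngNum b0') nu)); last first.
  by move=> A mA _; rewrite [LHS](lebesgue_affine c b0 mA) -nuE.
rewrite ge0_integral_mscale//=; congr *%E.
have h := ge0_integral_pushforward mphi leb measurableT mf (fun y _ => f0 y).
apply: etrans h.
by apply: eq_measure_integral => A _ _; rewrite /pushforward nuE.
Qed.

(** The fundamental theorem of calculus on [[- n, n]], then dominated convergence. This is the form
    in which integration by parts against the normal density is used. *)
Lemma integral_derivative_eq0 (f F : R -> R) :
  leb.-integrable setT (EFin \o f) -> continuous f ->
  (forall x : R, is_derive x (1 : R) F (f x)) ->
  F n%:R - F (- n%:R) @[n --> \oo] --> 0 -> \int[leb]_x f x = 0.
Proof.
move=> intf cf dF F0.
have mf : measurable_fun setT (EFin \o f) by exact: measurable_int intf.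
pose I n : set R := `[- n%:R, n%:R]%classic.
have mI n : measurable (I n) by exact: measurable_itv.
have part n : (0 < n)%N -> (\int[leb]_(x in I n) (f x)%:E = (F n%:R - F (- n%:R))%:E)%E.
  move=> n0; rewrite /I (@continuous_FTC2 _ f F)//.
  - by rewrite -subr_gt0 opprK addr_gt0 // ltr0n.
  - exact: continuous_subspaceT.
  - have cF x : {for x, continuous F}.
      by apply/differentiable_continuous/derivable1_diffP; exact: ex_derive.
    split.
    + by move=> x _; exact: ex_derive.
    + by apply: cvg_at_right_filter; exact: cF.
    + by apply: cvg_at_left_filter; exact: cF.
  - by move=> x _; rewrite derive1E; exact: derive_val.
have dom : (\int[leb]_(x in I n) (f x)%:E @[n --> \oo] --> \int[leb]_x (f x)%:E)%E.
  under eq_fun do rewrite integral_mkcond.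
  have mfI n : measurable_fun setT ((EFin \o f) \_ (I n)).
    by apply/(measurable_restrictT _ (mI n)); exact: measurable_funTS mf.
  have cvgI : {ae leb, forall x, [set: R] x ->
      ((EFin \o f) \_ (I n)) x @[n --> \oo] --> (EFin \o f) x}.
    apply: aeW => x _; apply: cvg_near_cst.
    near=> n; rewrite patchE ifT// inE /I/= in_itv/= -ler_norml.
    by near: n; exact: nbhs_infty_ger.
  have domI : {ae leb, forall x n, [set: R] x ->
      (`|((EFin \o f) \_ (I n)) x| <= `|f x|%:E)%E}.
    apply: aeW => x n _; rewrite patchE; case: ifP => _ /=; first by [].
    by rewrite normr0 lee_fin.
  by have [_ _] := @dominated_convergence _ (measurableTypeR R) R leb setT
    measurableT _ _ _ mfI mf cvgI (integrable_abse intf) domI.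
have F0' : ((F n%:R - F (- n%:R))%:E @[n --> \oo] --> (0:R)%:E)%E.
  by apply/cvg_EFin => //; exact: nearW.
rewrite /Rintegral; have -> // : (\int[leb]_x (f x)%:E = 0)%E.
apply: cvg_unique dom _ => //.
apply: cvg_trans F0'; apply: near_eq_cvg; near=> n.
by rewrite part//; near: n; exact: nbhs_infty_gt.
Unshelve. all: end_near. Qed.

Lemma normal_pdf01E (x : R) :
  normal_pdf 0 1 x = normal_peak 1 * expR (- x ^+ 2 / 2).
Proof.
by rewrite normal_pdfE ?oner_neq0// /normal_fun subr0 expr1n.
Qed.

Lemma is_derive_normal_pdf01 (x : R) :
  is_derive x (1 : R) (normal_pdf 0 1) (- x * normal_pdf 0 1 x).
Proof.
have -> : normal_pdf 0 1 =
    normal_peak 1 \*: (expR \o (- 2^-1 \*: (@idfun R) ^+ 2)) :> (R -> R).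
  apply/funext => y; rewrite normal_pdf01E /= /GRing.scale/=.
  by congr (_ * expR _); rewrite exprfctE /= mulrC mulrN mulNr.
apply: trigger_derive.
by rewrite /= /GRing.scale/=; field.
Qed.

Lemma normal_pdf01_cvg0 : normal_pdf 0 1 (n%:R : R) @[n --> \oo] --> (0 : R).
Proof.
apply/cvgr0Pnorm_le => /= e e0; near=> n.
rewrite ger0_norm ?normal_pdf_ge0// normal_pdf01E.
have : 0 < normal_peak 1 :> R by rewrite normal_peak_gt0 ?oner_neq0.
(* With [m = n%:R], the bound [expR (m ^ 2 / 2) >= 1 + m ^ 2 / 2 >= m / 2] reduces the claim to
   [m / 2 >= normal_peak 1 / e]. *)
have : 2 * (normal_peak 1 / e) <= (n%:R : R) by near: n; exact: nbhs_infty_ger.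
have : 1 <= (n%:R : R) by near: n; exact: nbhs_infty_ger.
move: (normal_peak 1) (n%:R : R) => P m m1 Pm P0.
rewrite mulNr expRN ler_pdivrMr ?expR_gt0// mulrC -ler_pdivrMr//.
apply: le_trans (expR_ge1Dx _).
have : m <= m ^+ 2 by rewrite expr2 ler_peMl//; lra.
by move: (P / e) Pm => q; lra.
Unshelve. all: end_near. Qed.

(** The density of standard deviation 2 dominates up to a constant: [expR (3 * x ^ 2 / 8) >= 1 + 3 *
    x ^ 2 / 8 >= |x|], and the exponent [3 / 8 = 1 / 2 - 1 / 8] is what separates the two
    densities. *)
Lemma integrable_norm_normal_pdf01 :
  leb.-integrable setT (fun x : measurableTypeR R => (`|x| * normal_pdf 0 1 x)%:E).
Proof.
have p2 : 0 < normal_peak 2 :> R by rewrite normal_peak_gt0 ?pnatr_eq0.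
pose K : R := normal_peak 1 / normal_peak 2.
have int2 := integrableZl measurableT K (integrable_normal_pdf (0 : R) 2).
apply: le_integrable int2 => //.
  apply/measurable_EFinP; apply: measurable_funM.
    by apply: continuous_measurable_fun => x; exact: norm_continuous.
  exact: measurable_normal_pdf.
move=> x _; rewrite /= lee_fin !normrM normr_id !(ger0_norm (normal_pdf_ge0 _ _ _)).
rewrite (ger0_norm (normal_peak_ge0 _))
  (@ger0_norm _ (normal_peak 2)^-1) ?invr_ge0 ?normal_peak_ge0//.
rewrite normal_pdf01E normal_pdfE ?pnatr_eq0// /normal_fun /K /= subr0 [leRHS]mulrA divfK ?gt_eqF//.
rewrite mulrCA ler_wpM2l ?normal_peak_ge0//.
rewrite (_ : expR (- x ^+ 2 / (2 ^+ 2 *+ 2)) =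
  expR (3 * x ^+ 2 / 8) * expR (- x ^+ 2 / 2)); last first.
  by rewrite -expRD; congr expR; field.
rewrite ler_wpM2r ?expR_ge0//; apply: le_trans (expR_ge1Dx _).
have [h1 h2] := (sqr_ge0 ((x : R) + 4 / 3), sqr_ge0 ((x : R) - 4 / 3)).
by rewrite ler_norml; apply/andP; split; move: (x : R) h1 h2 => {}x; nra.
Qed.

(** The integral [F] solves [F' = - t F] with [F 0 = 1], so [F t * expR (t ^ 2 / 2)] is constant. *)
Lemma Rintegral_cos_normal_pdf01 (t : R) :
  \int[leb]_x (cos (t * x) * normal_pdf 0 1 x) = expR (- t ^+ 2 / 2).
Proof.
pose f (t x : R) := cos (t * x) * normal_pdf 0 1 x.
pose F (t : R) := \int[leb]_x f t x.
have mp : measurable_fun setT (normal_pdf 0 1 : measurableTypeR R -> R).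
  exact: measurable_normal_pdf.
have mcos s : measurable_fun setT (fun x : measurableTypeR R => cos (s * x) : R).
  apply: continuous_measurable_fun => x.
  by apply: continuous_comp; [exact: mulrl_continuous|exact: continuous_cos].
have msin s : measurable_fun setT (fun x : measurableTypeR R => sin (s * x) : R).
  apply: continuous_measurable_fun => x.
  by apply: continuous_comp; [exact: mulrl_continuous|exact: continuous_sin].
have intf s : leb.-integrable setT (EFin \o f s).
  apply: le_integrable (integrable_normal_pdf 0 1) => //.
    by apply/measurable_EFinP; apply: measurable_funM.
  move=> x _; rewrite /= lee_fin normrM ler_piMl//.
  by rewrite ler_norml cos_geN1 cos_le1.
have intg s : leb.-integrable setT
    (fun x : measurableTypeR R => (x * sin (s * x) * normal_pdf 0 1 x)%:E).
  apply: le_integrable integrable_norm_normal_pdf01 => //.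
    by apply/measurable_EFinP; apply: measurable_funM => //; apply: measurable_funM.
  move=> x _; rewrite /= lee_fin !normrM normr_id ler_wpM2r// ler_piMr//.
  by rewrite ler_norml sin_geN1 sin_le1.
have df (s x : R) : is_derive s (1 : R) (f ^~ x) (- (x * sin (s * x) * normal_pdf 0 1 x)).
  have -> : f ^~ x = normal_pdf 0 1 x \*: (cos \o (x \*: @idfun R)).
    by apply/funext => y; rewrite /f /= /GRing.scale/= mulrC (mulrC x).
  apply: trigger_derive.
  by rewrite /= /GRing.scale/= (mulrC x s); ring.
(* Differentiation under the integral, then integration by parts. *)
have dF (s : R) : is_derive s (1 : R) F (- s * F s).
  have Is : `](s - 1), (s + 1)[%classic s.
    by rewrite /= in_itv/=; lra.
  have bound (x y : R) : `](s - 1), (s + 1)[%classic x -> [set: R] y ->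
      `|partial1of2 f x y| <= `|y| * normal_pdf 0 1 y.
    move=> _ _; rewrite partial1of2E derive_val normrN !normrM.
    rewrite (ger0_norm (normal_pdf_ge0 _ _ _)) ler_wpM2r ?normal_pdf_ge0//.
    by rewrite ler_piMr// ler_norml sin_geN1 sin_le1.
  have der (x y : R) : `](s - 1), (s + 1)[%classic x -> [set: R] y ->
     derivable (f ^~ y) x 1 by move=> _ _; exact: ex_derive.
  have intfx (x : R) : `](s - 1), (s + 1)[%classic x -> leb.-integrable setT (EFin \o f x).
    by move=> _; exact: intf.
  have G0 (y : R) : 0 <= `|y| * normal_pdf 0 1 y.
    by rewrite mulr_ge0// normal_pdf_ge0.
  have der1 := @derivable_under_integral R _ _ leb f setT measurableT s _ _ Is
    intfx der _ G0 integrable_norm_normal_pdf01 bound.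
  have der2 := @differentiation_under_integral R _ _ leb f setT measurableT s _ _ Is
    intfx der _ G0 integrable_norm_normal_pdf01 bound.
  apply: DeriveDef; first exact: der1.
  rewrite -derive1E der2.
  have -> : \int[leb]_y partial1of2 f s y =
      - \int[leb]_y (y * sin (s * y) * normal_pdf 0 1 y).
    rewrite -mulN1r -RintegralZl//; last exact: intg.
    apply: eq_Rintegral => y _.
    by rewrite partial1of2E derive_val mulN1r.
  have : \int[leb]_y (s * f s y - y * sin (s * y) * normal_pdf 0 1 y) = 0.
    apply: (@integral_derivative_eq0 _ (fun y => sin (s * y) * normal_pdf 0 1 y)).
    - rewrite (_ : EFin \o _ = ((fun y => s%:E * (EFin \o f s) y)
        \- (fun y => (y * sin (s * y) * normal_pdf 0 1 y)%:E))%E)//.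
      by apply: integrableB => //; exact: integrableZl.
    - have cp := @continuous_normal_pdf R 0 1 (oner_neq0 R).
      move=> x; apply: cvgB; apply: cvgM.
      + exact: cvg_cst.
      + apply: cvgM; last exact: cp.
        by apply: continuous_comp; [exact: mulrl_continuous|exact: continuous_cos].
      + apply: cvgM; first exact: cvg_id.
        by apply: continuous_comp; [exact: mulrl_continuous|exact: continuous_sin].
      + exact: cp.
    - move=> x.
      have dp := is_derive_normal_pdf01 x.
      have -> : (fun y => sin (s * y) * normal_pdf 0 1 y) =
          (sin \o (s \*: @idfun R)) * (normal_pdf 0 1 : R -> R) by [].
      apply: trigger_derive.
      by rewrite /f /= /GRing.scale/=; ring.
    - have : 2 * normal_pdf 0 1 (n%:R : R) @[n --> \oo] --> (0 : R).
        by have := cvgM (cvg_cst (2 : R)) normal_pdf01_cvg0; rewrite mulr0; exact.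
      move/cvgr0Pnorm_le => h; apply/cvgr0Pnorm_le => e e0.
      near=> n; have hn : `|2 * normal_pdf 0 1 (n%:R : R)| <= e.
        by near: n; exact: h.
      apply: le_trans hn; rewrite mulrN sinN !normal_pdf01E sqrrN (mulNr (sin _))
        opprK -mulr2n -[_ *+ 2]mulr_natl.
      rewrite !normrM ler_wpM2l// ler_piMl ?mulr_ge0//.
      by rewrite ler_norml sin_geN1 sin_le1.
  rewrite RintegralB//; last 2 first.
  - exact: (integrableZl measurableT s (intf s)).
  - exact: intg.
  rewrite RintegralZl//.
  by move/eqP; rewrite subr_eq0 => /eqP <-; rewrite mulNr.
have cst (s : R) : F s * expR (s ^+ 2 / 2) = F 0 * expR (0 ^+ 2 / 2).
  pose G (s : R) := F s * expR (s ^+ 2 / 2).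
  rewrite -[LHS]/(G s) -[RHS]/(G 0).
  apply: is_derive_0_is_cst => u.
  have -> : G = F * (expR \o (2^-1 \*: (@idfun R) ^+ 2)).
    by apply/funext => y; rewrite /G (mulrC (y ^+ 2)).
  have := dF u; move=> ?.
  apply: trigger_derive.
  by rewrite /= /GRing.scale/=; field.
have F0 : F 0 = 1.
  rewrite /F /Rintegral (_ : integral _ _ _ = 1%E)//.
  rewrite -(integral_normal_pdf 0 1); apply: eq_integral => x _.
  by rewrite /f mul0r cos0 mul1r.
rewrite -[LHS]/(F t) mulNr expRN; apply: (mulIf (lt0r_neq0 (expR_gt0 (t ^+ 2 / 2)))).
by rewrite mulVf ?gt_eqF ?expR_gt0// cst F0 expr0n mul0r expR0 mulr1.
Unshelve. all: end_near. Qed.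

Lemma integrable_affine (b c : R) (f : R -> R) : b != 0 ->
  leb.-integrable setT (EFin \o f) ->
  leb.-integrable setT (EFin \o (fun x : measurableTypeR R => f (c + b * x))).
Proof.
move=> b0 intf.
have mEf : measurable_fun setT (EFin \o f) by exact: measurable_int intf.
have mf : measurable_fun setT f by apply/measurable_EFinP.
have mphi : measurable_fun setT
    (fun x : measurableTypeR R => c + b * x : measurableTypeR R).
  by apply: measurable_funD => //; apply: measurable_funM.
apply/integrableP; split.
  by apply/measurable_EFinP; exact: (measurableT_comp mf mphi).
have /integrableP[_] := intf.
rewrite (@ge0_integral_affine b c (fun x => `|(EFin \o f) x|%E))//; last first.
  by apply: measurableT_comp => //; exact/measurable_EFinP.
apply: contraTT; rewrite -!leNgt !leye_eq => /eqP /= ->.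
by rewrite gt0_muley// lte_fin normr_gt0.
Qed.

Lemma Rintegral_affine (b c : R) (f : R -> R) : b != 0 ->
  leb.-integrable setT (EFin \o f) ->
  \int[leb]_x f x = `|b| * \int[leb]_x f (c + b * x).
Proof.
move=> b0 intf.
have mEf : measurable_fun setT (EFin \o f) by exact: measurable_int intf.
have mphi : measurable_fun setT
    (fun x : measurableTypeR R => c + b * x : measurableTypeR R).
  by apply: measurable_funD => //; apply: measurable_funM.
have intfphi := integrable_affine c b0 intf.
rewrite -RintegralZl//.
apply/EFin_inj; rewrite /Rintegral !fineK; last 2 first.
- rewrite integrable_fin_num//.
  exact: (integrableZl measurableT `|b| intfphi).
- exact: integrable_fin_num.
rewrite integralE [in RHS]integralE; congr (_ - _)%E.
- rewrite (@ge0_integral_affine b c) //; last exact: measurable_funepos.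
  rewrite -ge0_integralZl//; last first.
    exact: (measurableT_comp (measurable_funepos mEf) mphi).
  apply: eq_integral => x _.
  by rewrite !funeposE /= -!EFin_max -EFinM maxr_pMr// mulr0.
- rewrite (@ge0_integral_affine b c) //; last exact: measurable_funeneg.
  rewrite -ge0_integralZl//; last first.
    exact: (measurableT_comp (measurable_funeneg mEf) mphi).
  apply: eq_integral => x _.
  by rewrite !funenegE /= -!EFin_max -EFinM maxr_pMr// mulr0 mulrN.
Qed.

Lemma Rintegral_normal_prob (m s : R) (f : R -> R) (M : R) :
  measurable_fun setT f -> (forall x, `|f x| <= M) ->
  \int[normal_prob m s]_x f x = \int[leb]_x (f x * normal_pdf m s x).
Proof.
move=> mf fM; rewrite /Rintegral integral_normal_prob//.
exact: (@bounded_integrable _ (measurableTypeR R) R (normal_prob m s) f M).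
Qed.

(** The factor [expR (- a * x ^ 2)] only changes the variance: its product with the density is, up
    to a constant, the centred density of standard deviation [b = s / sqrt (1 + 2 * a * s ^ 2)].
    Rescaling by [b] leaves the standard cosine integral. *)
Lemma Rintegral_cos_normal_prob (s a t : R) : 0 < s -> 0 <= a ->
  \int[normal_prob 0 s]_x (cos (t * x) * expR (- a * x ^+ 2)) =
  (Num.sqrt (1 + 2 * a * s ^+ 2))^-1 *
  expR (- t ^+ 2 * s ^+ 2 / (2 * (1 + 2 * a * s ^+ 2))).
Proof.
move=> s0 a0.
have mcos : measurable_fun setT (fun x : measurableTypeR R => cos (t * x) : R).
  apply: continuous_measurable_fun => x.
  by apply: continuous_comp; [exact: mulrl_continuous|exact: continuous_cos].
have mg : measurable_fun setT
    (fun x : measurableTypeR R => cos (t * x) * expR (- a * x ^+ 2) : R).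
  apply: measurable_funM => //; apply: measurableT_comp => //.
  by apply: measurable_funM => //; exact: measurable_funX.
have gM (x : R) : `|cos (t * x) * expR (- a * x ^+ 2)| <= 1.
  rewrite normrM (ger0_norm (expR_ge0 _)) mulr_ile1 ?normr_ge0 ?expR_ge0//.
    exact: cos_max.
  by rewrite -expR0 ler_expR mulNr oppr_le0 mulr_ge0// sqr_ge0.
rewrite (Rintegral_normal_prob _ _ mg gM).
set D := 1 + 2 * a * s ^+ 2.
have D0 : 0 < D by rewrite /D ltr_wpDr// mulr_ge0 ?sqr_ge0 ?mulr_ge0.
pose r := Num.sqrt D.
have r0 : 0 < r by rewrite sqrtr_gt0.
have r2 : r ^+ 2 = D by rewrite sqr_sqrtr// ltW.
pose b := s / r.
have b0 : 0 < b by rewrite divr_gt0.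
have intgs : leb.-integrable setT (EFin \o (fun x : measurableTypeR R =>
    cos (t * x) * expR (- a * x ^+ 2) * normal_pdf 0 s x)).
  apply: le_integrable (integrable_normal_pdf 0 s) => //.
    by apply/measurable_EFinP; apply: measurable_funM => //; exact: measurable_normal_pdf.
  move=> x _; rewrite /= lee_fin normrM ler_piMl//; exact: gM.
have b2 : b ^+ 2 = s ^+ 2 / D by rewrite /b expr_div_n r2.
have bn0 : b != 0 by rewrite gt_eqF.
rewrite (@Rintegral_affine b 0)//.
transitivity (r^-1 * \int[leb]_x (cos (t * b * x) * normal_pdf 0 1 x)).
  rewrite -!RintegralZl//; last 2 first.
  - apply: le_integrable (integrable_normal_pdf 0 1) => //.
      apply/measurable_EFinP; apply: measurable_funM; last exact: measurable_normal_pdf.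
      apply: continuous_measurable_fun => x.
      by apply: continuous_comp; [exact: mulrl_continuous|exact: continuous_cos].
    by move=> x _; rewrite /= lee_fin normrM ler_piMl//; exact: cos_max.
  - exact: (integrable_affine 0 bn0 intgs).
  apply: eq_Rintegral => x _.
  rewrite add0r mulrA normal_pdf01E normal_pdfE ?gt_eqF//.
  rewrite /normal_fun subr0 gtr0_norm//.
  have pk : normal_peak s = normal_peak 1 / s :> R.
    rewrite /normal_peak expr1n mul1r -invfM -mulrnAr sqrtrM ?sqr_ge0//.
    by rewrite sqrtr_sqr gtr0_norm// mulrC.
  rewrite pk.
  rewrite [LHS](_ : _ = b / s * (cos (t * (b * x)) * (normal_peak 1 *
    (expR (- a * (b * x) ^+ 2) * expR (- (b * x) ^+ 2 / (s ^+ 2 *+ 2)))))); last by ring.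
  rewrite -expRD.
  have -> : - a * (b * x) ^+ 2 + - (b * x) ^+ 2 / (s ^+ 2 *+ 2) = - x ^+ 2 / 2.
    rewrite exprMn b2; move: D0; rewrite /D => D0; field.
    by rewrite !gt_eqF//= ?exprn_gt0.
  rewrite -[t * b * x]mulrA; congr (_ * _).
  by rewrite /b mulrAC divff ?mul1r ?gt_eqF.
rewrite Rintegral_cos_normal_pdf01; congr (_ * expR _).
rewrite mulNr exprMn b2; field; by rewrite gt_eqF.
Qed.

Lemma normal_peakE (s : R) : 0 < s ->
  normal_peak s = (s * Num.sqrt (pi *+ 2))^-1.
Proof.
move=> s0; rewrite /normal_peak -mulrnAr sqrtrM ?sqr_ge0// sqrtr_sqr.
by rewrite gtr0_norm.
Qed.

Lemma normal_prob_affine (b c : R) (A : set R) : b != 0 -> measurable A ->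
  normal_prob 0 1 ((fun x => c + b * x) @^-1` A) = normal_prob c `|b| A.
Proof.
move=> b0 mA; rewrite /normal_prob [LHS]integral_mkcond [RHS]integral_mkcond.
rewrite [RHS](@ge0_integral_affine b c)//; last 2 first.
- apply/(measurable_restrictT _ mA); apply: measurable_funTS; apply/measurable_EFinP.
  exact: measurable_normal_pdf.
- by move=> x; apply: erestrict_ge0 => y _; rewrite lee_fin normal_pdf_ge0.
rewrite -ge0_integralZl//; last 2 first.
- apply: (measurableT_comp (f := (fun x => (normal_pdf c `|b| x)%:E) \_ A)).
    apply/(measurable_restrictT _ mA); apply: measurable_funTS; apply/measurable_EFinP.
    exact: measurable_normal_pdf.
  by apply: measurable_funD => //; apply: measurable_funM.
- by move=> x _; apply: erestrict_ge0 => y _; rewrite lee_fin normal_pdf_ge0.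
apply: eq_integral => x _; rewrite !patchE.
have -> : (x \in (fun x => c + b * x) @^-1` A) = (c + b * x \in A).
  by apply/idP/idP; rewrite !inE.
case: ifPn => _; last by rewrite mule0.
rewrite -EFinM; congr EFin.
rewrite normal_pdf01E normal_pdfE ?normr_eq0// /normal_fun addrAC subrr add0r.
rewrite /normal_peak real_normK ?num_real// expr1n mul1r -mulrnAr sqrtrM ?sqr_ge0//.
rewrite sqrtr_sqr invfM !mulrA divff ?normr_eq0// mul1r exprMn; congr (_ * expR _).
by field.
Qed.

(** Completing the square in [u]. For independent centred normals of deviations [s] and [b], the
    left side is the joint density of the first variable and the sum; the right side is the density
    of the sum times the conditional density of the first variable given the sum. *)
Lemma normal_pdfM (s b u x : R) : 0 < s -> 0 < b ->
  normal_pdf 0 s u * normal_pdf u b x =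
  normal_pdf 0 (Num.sqrt (s ^+ 2 + b ^+ 2)) x *
  normal_pdf (x * s ^+ 2 / (s ^+ 2 + b ^+ 2))
    (s * b / Num.sqrt (s ^+ 2 + b ^+ 2)) u.
Proof.
move=> s0 b0.
have D0 : 0 < s ^+ 2 + b ^+ 2 by rewrite addr_gt0 ?exprn_gt0.
set r := Num.sqrt _.
have r0 : 0 < r by rewrite sqrtr_gt0.
have r2 : r ^+ 2 = s ^+ 2 + b ^+ 2 by rewrite sqr_sqrtr// ltW.
have sb0 : 0 < s * b / r by rewrite divr_gt0// mulr_gt0.
rewrite !normal_pdfE ?gt_eqF// /normal_fun !subr0.
rewrite mulrACA -expRD [RHS]mulrACA -expRD; congr (_ * expR _).
  rewrite !normal_peakE//.
  have q0 : Num.sqrt (pi *+ 2) != 0 :> R.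
    by rewrite gt_eqF// sqrtr_gt0 pmulrn_lgt0// pi_gt0.
  by field; rewrite q0 !gt_eqF.
rewrite expr_div_n r2; field.
by rewrite !gt_eqF.
Qed.

Lemma normal_prob_indic (u b : R) (A : set R) :
  normal_prob u b A = (\int[leb]_x (normal_pdf u b x * \1_A x)%:E)%E.
Proof.
rewrite /normal_prob integral_mkcond; apply: eq_integral => x _.
by rewrite patchE indicE; case: ifPn => _; rewrite ?mulr1 ?mulr0.
Qed.

Lemma measurable_normal_pdf_indic (b : R) (A : set R) : 0 < b -> measurable A ->
  measurable_fun setT (fun z : measurableTypeR R * measurableTypeR R =>
    (normal_pdf z.1 b z.2 * \1_A z.2)%:E).
Proof.
move=> b0 mA; apply/measurable_EFinP; apply: measurable_funM; last first.
  by apply: measurableT_comp => //; exact: measurable_indic.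
rewrite (_ : (fun z => _) = (fun z => normal_peak b *
    expR (- (z.2 - z.1) ^+ 2 / (b ^+ 2 *+ 2)))); last first.
  by apply/funext => z; rewrite normal_pdfE ?gt_eqF.
apply: measurable_funM => //; apply: measurableT_comp => //.
apply: measurable_funM => //; apply: measurableT_comp => //.
by apply: measurable_funX; exact: measurable_funB.
Qed.

Lemma measurable_normal_prob_mean (b : R) (A : set R) : 0 < b -> measurable A ->
  measurable_fun setT (fun u : measurableTypeR R => normal_prob u b A).
Proof.
move=> b0 mA.
pose K (z : measurableTypeR R * measurableTypeR R) : \bar R :=
  (normal_pdf z.1 b z.2 * \1_A z.2)%:E.
have mK : measurable_fun setT K by exact: measurable_normal_pdf_indic.
have KE u : normal_prob u b A = (\int[leb]_x K (u, x))%E by exact: normal_prob_indic.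
have K0 z : (0 <= K z)%E by rewrite lee_fin mulr_ge0 ?normal_pdf_ge0.
rewrite (_ : (fun u => _) = fubini_F leb K); last by apply/funext => u; rewrite KE.
exact: measurable_fun_fubini_tonelli_F.
Qed.

(** After exchanging the integrals by Tonelli, the conditional density in [normal_pdfM] integrates
    to 1 and the density of the sum remains. *)
Lemma normal_prob_convolution (s b : R) (A : set R) : 0 < s -> 0 < b ->
  measurable A ->
  (\int[normal_prob 0 s]_u normal_prob u b A =
   normal_prob 0 (Num.sqrt (s ^+ 2 + b ^+ 2)) A)%E.
Proof.
move=> s0 b0 mA.
pose K (z : measurableTypeR R * measurableTypeR R) : \bar R :=
  (normal_pdf z.1 b z.2 * \1_A z.2)%:E.
have mK : measurable_fun setT K by exact: measurable_normal_pdf_indic.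
have KE u : normal_prob u b A = (\int[leb]_x K (u, x))%E by exact: normal_prob_indic.
have K0 z : (0 <= K z)%E by rewrite lee_fin mulr_ge0 ?normal_pdf_ge0.
have mN := measurable_normal_prob_mean b0 mA.
rewrite integral_normal_prob; last first.
  apply/integrableP; split => //.
  apply: (@le_lt_trans _ _ (\int[normal_prob 0 s]_x 1)%E).
    apply: ge0_le_integral => //; first exact: measurableT_comp.
    by move=> x _; rewrite gee0_abs ?measure_ge0// probability_le1.
  by rewrite integral_cst//= mul1e /normal_prob integral_normal_pdf ltry.
transitivity (\int[leb]_u \int[leb]_x ((normal_pdf 0 s u)%:E * K (u, x)))%E.
  apply: eq_integral => u _; rewrite KE muleC ge0_integralZl//.
  - by apply: measurableT_comp => //.
  - by rewrite lee_fin normal_pdf_ge0.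
rewrite (@fubini_tonelli _ _ _ _ _ leb leb (fun z => (normal_pdf 0 s z.1)%:E * K z)%E)/=; last 2 first.
- apply: emeasurable_funM => //; apply/measurable_EFinP.
  by apply: measurableT_comp => //; exact: measurable_normal_pdf.
- by move=> z; rewrite mule_ge0// lee_fin normal_pdf_ge0.
rewrite /normal_prob [RHS]integral_mkcond; apply: eq_integral => x _.
rewrite patchE /K /=.
under eq_integral => u _ do rewrite -EFinM mulrA normal_pdfM// indicE mulrAC EFinM.
rewrite ge0_integralZl//; last 3 first.
- by apply/measurable_EFinP; exact: measurable_normal_pdf.
- by move=> u _; rewrite lee_fin normal_pdf_ge0.
- by rewrite lee_fin mulr_ge0 ?normal_pdf_ge0.
rewrite integral_normal_pdf mule1.
by case: ifPn => _; rewrite ?mulr1 ?mulr0.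
Qed.

End normal_line.

(** * Orthonormal sequences and eigensystems *)

Section inner_product.
Context (R : realType) (H : completeNormedModType R) (ip : {dot H for idfun}).
Implicit Types (u v w : H) (a : R) (e : nat -> H).

Lemma ipC u v : ip u v = ip v u.
Proof. by rewrite hermC expr0 mul1r. Qed.

Lemma ipZl a u v : ip (a *: u) v = a * ip u v.
Proof. exact: linearZl_LR. Qed.

Lemma ipZr a u v : ip u (a *: v) = a * ip u v.
Proof. exact: linearZr_LR. Qed.

Lemma ipDl u v w : ip (u + v) w = ip u w + ip v w. Proof. exact: linearDl. Qed.

Lemma ipDr w u v : ip w (u + v) = ip w u + ip w v. Proof. exact: linearDr. Qed.

Lemma ipBl u v w : ip (u - v) w = ip u w - ip v w. Proof. exact: linearBl. Qed.

Lemma ipBr w u v : ip w (u - v) = ip w u - ip w v. Proof. exact: linearBr. Qed.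

Lemma ip0l u : ip 0 u = 0. Proof. exact: linear0l. Qed.

Lemma ip0r u : ip u 0 = 0. Proof. exact: linear0r. Qed.

Lemma ip_suml (I : Type) (r : seq I) (P : pred I) (f : I -> H) v :
  ip (\sum_(i <- r | P i) f i) v = \sum_(i <- r | P i) ip (f i) v.
Proof. exact: linear_sumlz. Qed.

Lemma ip_sumr (I : Type) (r : seq I) (P : pred I) (f : I -> H) v :
  ip v (\sum_(i <- r | P i) f i) = \sum_(i <- r | P i) ip v (f i).
Proof. exact: linear_sumr. Qed.

Hypothesis Hip : induces_norm ip.

Lemma ip_ge0 u : 0 <= ip u u. Proof. by rewrite Hip sqr_ge0. Qed.

Lemma ip_eq0 u : (ip u u == 0) = (u == 0).
Proof. by rewrite Hip sqrf_eq0 normr_eq0. Qed.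

Lemma cauchy_schwarz u v : ip u v ^+ 2 <= ip u u * ip v v.
Proof.
have [->|v0] := eqVneq v 0; first by rewrite !ip0r mulr0 expr0n.
have vv0 : 0 < ip v v by rewrite lt_neqAle ip_ge0 andbT eq_sym ip_eq0.
have := mulr_ge0 (ip_ge0 (u - (ip u v / ip v v) *: v)) (ltW vv0).
rewrite !(ipBl, ipBr, ipZl, ipZr) (ipC v u) -subr_ge0.
by congr (_ <= _); field; rewrite gt_eqF.
Qed.

Lemma ip_continuous u : continuous (ip u : H -> R).
Proof.
move=> v; apply/cvgrPdist_le => /= e e0.
near=> w.
rewrite -ipBr -(@ler_pXn2r _ 2)// ?nnegrE ?(ltW e0)// real_normK ?num_real//.
apply: (le_trans (cauchy_schwarz _ _)).
rewrite !Hip -exprMn ler_pXn2r ?nnegrE ?mulr_ge0 ?(ltW e0)//.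
have : `|v - w| <= e / (`|u| + 1).
  near: w; have /cvgrPdist_le := @cvg_id _ (nbhs v); apply.
  by rewrite divr_gt0// ltr_wpDl.
have u1 : 0 < `|u| + 1 by rewrite ltr_wpDl.
rewrite ler_pdivlMr// mulrDr mulr1 mulrC => h.
by rewrite (le_trans _ h)// lerDl.
Unshelve. all: end_near. Qed.

Definition orthonormal_seq e := forall i j, ip (e i) (e j) = (i == j)%:R.

Definition proj e m v := \sum_(i < m) ip (e i) v *: e i.

Section orthonormal.
Variable e : nat -> H.
Hypothesis oe : orthonormal_seq e.

Lemma ip_comb m (c : nat -> R) j :
  ip (e j) (\sum_(i < m) c i *: e i) = if (j < m)%N then c j else 0.
Proof.
rewrite ip_sumr; case: ifPn => [jm|].
  rewrite (bigD1 (Ordinal jm))//= ipZr oe eqxx mulr1 big1 ?addr0// => i ij.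
  rewrite ipZr oe (_ : (j == i) = false) ?mulr0//.
  by apply: contraNF ij => /eqP ji; apply/eqP/val_inj.
rewrite -leqNgt => mj; apply: big1 => i _.
by rewrite ipZr oe gtn_eqF ?mulr0// (leq_trans (ltn_ord i)).
Qed.

Lemma ip_comb_comb m (c : nat -> R) :
  ip (\sum_(i < m) c i *: e i) (\sum_(i < m) c i *: e i) = \sum_(i < m) c i ^+ 2.
Proof.
rewrite ip_suml; apply: eq_bigr => i _.
by rewrite ipZl ip_comb ltn_ord expr2.
Qed.

Lemma ip_proj m v j : ip (e j) (proj e m v) = if (j < m)%N then ip (e j) v else 0.
Proof. exact: (ip_comb m (fun i => ip (e i) v) j). Qed.

Lemma ip_sub_proj m v j : (j < m)%N -> ip (e j) (v - proj e m v) = 0.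
Proof. by move=> jm; rewrite ipBr ip_proj jm subrr. Qed.

Lemma ip_proj_sub_proj m u v : ip (proj e m u) (v - proj e m v) = 0.
Proof.
rewrite ip_suml; apply: big1 => i _.
by rewrite ipZl ip_sub_proj ?mulr0.
Qed.

Lemma norm_sub_proj m v :
  ip (v - proj e m v) (v - proj e m v) = ip v v - \sum_(i < m) ip (e i) v ^+ 2.
Proof.
rewrite [LHS]ipBl ip_proj_sub_proj subr0 ipBr; congr (_ - _).
by rewrite ip_sumr; apply: eq_bigr => i _; rewrite ipZr (ipC v) expr2.
Qed.

Lemma bessel m v : \sum_(i < m) ip (e i) v ^+ 2 <= ip v v.
Proof. by rewrite -subr_ge0 -norm_sub_proj ip_ge0. Qed.

(** By Bessel the squared coefficients are summable, so they tend to 0. *)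
Lemma ip_orthonormal_cvg0 v : ip (e n) v @[n --> \oo] --> (0 : R).
Proof.
have cs : cvgn (series (fun n => ip (e n) v ^+ 2)).
  apply: nondecreasing_is_cvgn.
    by apply/nondecreasing_seqP => n; rewrite /series/= big_nat_recr//= lerDl sqr_ge0.
  exists (ip v v) => _ [n _ <-]; rewrite /series/= big_mkord; exact: bessel.
have /cvgr0Pnorm_lt h := cvg_series_cvg_0 cs.
apply/cvgr0Pnorm_lt => /= d d0; near=> n.
have : `|ip (e n) v ^+ 2| < d ^+ 2.
  by near: n; apply: h; rewrite exprn_gt0.
by rewrite normrX ltr_pXn2r// ?nnegrE ?(ltW d0).
Unshelve. all: end_near. Qed.

End orthonormal.

(** [k] linear conditions on [k.+1] coefficients have a nonzero solution. The dimension count behind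
    both the min-max comparison of eigenvalues and the rank bound for the empirical covariance. *)
Lemma orthonormal_comb_orthogonal e k (b : 'I_k -> H) : orthonormal_seq e ->
  exists c : nat -> R, [/\ 0 < \sum_(i < k.+1) c i ^+ 2 &
    forall l, ip (b l) (\sum_(i < k.+1) c i *: e i) = 0].
Proof.
move=> oe.
pose M : 'M[R]_(k.+1, k) := \matrix_(i, l) ip (b l) (e i).
have [r rn0 rM] : exists2 r : 'rV[R]_k.+1, r != 0 & r *m M = 0.
  have : kermx M != 0.
    by rewrite kermx_eq0 /row_free neq_ltn (leq_ltn_trans (rank_leq_col M)).
  by case/rowV0Pn => r /sub_kermxP rM r0; exists r.
exists (fun i => r ord0 (inord i)).
have rE : r = \row_i r ord0 (inord i) by apply/rowP => i; rewrite mxE inord_val.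
split=> [|l].
  rewrite lt_neqAle sumr_ge0 ?andbT => [|i _]; last exact: sqr_ge0.
  rewrite eq_sym psumr_eq0 => [|i _]; last exact: sqr_ge0.
  apply: contra rn0 => /allP rz; apply/eqP/rowP => i; rewrite mxE.
  by have := rz i (mem_index_enum _); rewrite inord_val sqrf_eq0 => /eqP.
have /matrixP/(_ ord0 l) := rM; rewrite mxE [RHS]mxE => <-.
rewrite ip_sumr; apply: eq_bigr => i _.
by rewrite ipZr mxE inord_val.
Qed.

Section eigensystem_theory.
Variables (C : H -> H) (lam : nat -> R) (psi : nat -> H).
Hypothesis E : eigensystem ip C lam psi.

Lemma eigensystem_orthonormal : orthonormal_seq psi. Proof. by case: E. Qed.

Lemma eigensystem_ge0 j : 0 <= lam j. Proof. by case: E. Qed.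

Lemma eigensystem_le i j : (i <= j)%N -> lam j <= lam i. Proof. by case: E => _ _ /(_ i j). Qed.

Lemma eigensystem_cvg v :
  \sum_(j < n) (lam j * ip (psi j) v) *: psi j @[n --> \oo] --> C v.
Proof.
case: E => _ _ _ /(_ v) h; apply: (cvg_trans _ h); apply: near_eq_cvg; apply: nearW => n.
rewrite /series/= big_mkord.
by apply: eq_bigr => j _; rewrite /tensor scalerA.
Qed.

Lemma eigensystem_ip_cvg u v :
  \sum_(j < n) lam j * (ip (psi j) u * ip (psi j) v) @[n --> \oo] --> ip (C u) v.
Proof.
rewrite ipC.
have h := cvg_comp _ _ (@eigensystem_cvg u) (@ip_continuous v (C u)).
apply: (cvg_trans _ h); apply: near_eq_cvg; apply: nearW => n /=.
by rewrite ip_sumr; apply: eq_bigr => j _; rewrite ipZr (ipC v) mulrA.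
Qed.

Lemma eigensystem_sym u v : ip (C u) v = ip (C v) u.
Proof.
apply: cvg_unique (@eigensystem_ip_cvg u v) _ => //.
apply: (cvg_trans _ (@eigensystem_ip_cvg v u)); apply: near_eq_cvg; apply: nearW => n.
by apply: eq_bigr => j _; rewrite [X in _ * X]mulrC.
Qed.

(** [eigensystem] speaks of a bare function [C]; linearity, like symmetry above, is inherited from
    the partial sums through the strong limit. *)
Lemma eigensystem_linear a u v : C (a *: u + v) = a *: C u + C v.
Proof.
apply: cvg_unique (@eigensystem_cvg _) _ => //.
have h : a *: (\sum_(j < n) (lam j * ip (psi j) u) *: psi j) +
    \sum_(j < n) (lam j * ip (psi j) v) *: psi j @[n --> \oo] --> a *: C u + C v.
  by apply: cvgD; [apply: cvgZl_tmp|]; exact: eigensystem_cvg.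
apply: (cvg_trans _ h); apply: near_eq_cvg; apply: nearW => n /=.
rewrite scaler_sumr -big_split/=; apply: eq_bigr => j _.
by rewrite scalerA -scalerDl ipDr ipZr; congr (_ *: _); ring.
Qed.

Lemma eigensystem_eq0 v : (forall j, lam j * ip (psi j) v = 0) -> C v = 0.
Proof.
move=> h; apply: cvg_unique (@eigensystem_cvg _) _ => //.
rewrite (_ : (fun n => _) = cst 0); first exact: cvg_cst.
by apply/funext => n; apply: big1 => j _; rewrite h scale0r.
Qed.

Lemma eigensystem_psi k : C (psi k) = lam k *: psi k.
Proof.
apply: cvg_unique (@eigensystem_cvg _) _ => //.
apply: cvg_near_cst; near=> n.
have kn : (k < n)%N by near: n; exact: nbhs_infty_gt.
rewrite (bigD1 (Ordinal kn))//= eigensystem_orthonormal eqxx mulr1.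
rewrite big1 ?addr0// => i ik; rewrite eigensystem_orthonormal.
rewrite (_ : (val i == k) = false) ?mulr0 ?scale0r//.
by apply: contraNF ik => /eqP ik; apply/eqP/val_inj.
Unshelve. all: end_near. Qed.

(** Only the indices from [m] on contribute, with eigenvalues at most [lam m]; Bessel bounds the
    remaining coefficients. *)
Lemma eigensystem_form_le m v : (forall j, (j < m)%N -> ip (psi j) v = 0) ->
  ip (C v) v <= lam m * ip v v.
Proof.
move=> h; apply: (cvgr_to_le (@eigensystem_ip_cvg v v)).
near=> n; apply: le_trans (_ : lam m * \sum_(j < n) ip (psi j) v ^+ 2 <= _); last first.
  by rewrite ler_wpM2l ?eigensystem_ge0// bessel//; exact: eigensystem_orthonormal.
rewrite mulr_sumr; apply: ler_sum => j _; rewrite -expr2.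
have [jm|mj] := ltnP j m; first by rewrite h// expr0n !mulr0.
by rewrite ler_wpM2r ?sqr_ge0 ?eigensystem_le.
Unshelve. all: end_near. Qed.

End eigensystem_theory.

(** Courant-Fischer: take a nonzero [v] in the span of [psi_0, ..., psi_k] orthogonal to
    [psi'_0, ..., psi'_(k-1)]. The form at [v] is at least [lam k * ip v v] by the first property
    and at most [lam' k * ip v v] by the second. *)
Lemma eigensystem_values_le C lam psi lam' psi' k :
  eigensystem ip C lam psi -> eigensystem ip C lam' psi' -> lam k <= lam' k.
Proof.
move=> E E'; have oe := eigensystem_orthonormal E.
have [c [c0 cperp]] := orthonormal_comb_orthogonal (fun l : 'I_k => psi' l) oe.
set v := \sum_(i < k.+1) _ in cperp.
have vv : ip v v = \sum_(i < k.+1) c i ^+ 2 by exact: ip_comb_comb.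
rewrite -(ler_pM2r c0) -vv.
apply: le_trans (_ : ip (C v) v <= _); last first.
  apply: (eigensystem_form_le E') => j jk; exact: (cperp (Ordinal jk)).
rewrite vv mulr_sumr.
apply: (cvgr_to_ge (eigensystem_ip_cvg E (u:=v) (v:=v))); near=> n.
have kn : (k.+1 <= n)%N by near: n; exact: nbhs_infty_ge.
rewrite (big_ord_widen n (fun i => lam k * c i ^+ 2))// big_mkcond/=.
apply: ler_sum => j _; rewrite -expr2 ip_comb//.
case: ifPn => jk; last by rewrite expr0n mulr0.
by rewrite ler_wpM2r ?sqr_ge0 ?(eigensystem_le E).
Unshelve. all: end_near. Qed.

Lemma eigensystem_values_uniq C lam psi lam' psi' k :
  eigensystem ip C lam psi -> eigensystem ip C lam' psi' -> lam k = lam' k.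
Proof.
by move=> E E'; apply/eqP;
  rewrite eq_le !(eigensystem_values_le k E E', eigensystem_values_le k E' E).
Qed.

End inner_product.

(** * The empirical covariance and its rank *)

Section empirical.
Context (R : realType) (H : completeNormedModType R) (ip : {dot H for idfun}).
Hypothesis Hip : induces_norm ip.
Context (n : nat) (y : 'I_n -> H).
Implicit Types (u v w : H) (a : R).
Local Notation S := (empirical_covariance ip y).

Lemma empirical_form u v :
  ip (S u) v = n%:R^-1 * \sum_(i < n) ip (y i) u * ip (y i) v.
Proof.
rewrite ipZl ip_suml; congr (_ * _); apply: eq_bigr => i _.
by rewrite ipZl.
Qed.

Lemma empirical_sym u v : ip (S u) v = ip (S v) u.
Proof.
by rewrite !empirical_form; congr (_ * _); apply: eq_bigr => i _; rewrite mulrC.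
Qed.

Lemma empirical_linear a u v : S (a *: u + v) = a *: S u + S v.
Proof.
rewrite /empirical_covariance scalerA mulrC -scalerA -scalerDr; congr (_ *: _).
rewrite scaler_sumr -big_split/=; apply: eq_bigr => i _.
by rewrite /tensor ipDr ipZr scalerDl scalerA.
Qed.

Lemma empirical_sum m (c : nat -> R) (e : nat -> H) :
  S (\sum_(i < m) c i *: e i) = \sum_(i < m) c i *: S (e i).
Proof.
elim: m => [|m IH].
  rewrite !big_ord0 /empirical_covariance big1 ?scaler0// => i _.
  by rewrite /tensor ip0r scale0r.
by rewrite !big_ord_recr/= [X in S X]addrC empirical_linear IH addrC.
Qed.

Lemma empirical_form_eq0 v : (0 < n)%N -> ip (S v) v <= 0 -> forall i, ip (y i) v = 0.
Proof.
move=> n0; rewrite empirical_form pmulr_rle0 ?invr_gt0 ?ltr0n// => le0 i.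
have : \sum_(i < n) ip (y i) v * ip (y i) v == 0.
  by rewrite eq_le le0 sumr_ge0// => j _; rewrite -expr2 sqr_ge0.
rewrite psumr_eq0 => [|j _]; last by rewrite -expr2 sqr_ge0.
by move=> /allP/(_ i (mem_index_enum _)); rewrite -expr2 sqrf_eq0 => /eqP.
Qed.

Lemma empirical_eq0 v : (forall i, ip (y i) v = 0) -> S v = 0.
Proof.
move=> h; rewrite /empirical_covariance big1 ?scaler0// => i _.
by rewrite /tensor h scale0r.
Qed.

(** Some nonzero combination of the [n.+1] eigenvectors [psi_0, ..., psi_n] is orthogonal to all [n]
    data, hence killed by the operator; so one of [mu_0, ..., mu_n] is 0, and monotonicity does the
    rest. The hypotheses are weaker than [eigensystem] because the lemma also serves to construct
    one. *)
Lemma empirical_rank (mu : nat -> R) (psi : nat -> H) :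
  orthonormal_seq ip psi -> (forall k, S (psi k) = mu k *: psi k) ->
  (forall k, 0 <= mu k) -> (forall i j, (i <= j)%N -> mu j <= mu i) ->
  forall k, (n <= k)%N -> mu k = 0.
Proof.
move=> oe Se mu0 mule.
suff mun : mu n = 0.
  by move=> k nk; apply/eqP; rewrite eq_le mu0 andbT -mun mule.
have [c [c0 cperp]] := orthonormal_comb_orthogonal y oe.
have Sv := empirical_eq0 cperp.
have cmu (i : 'I_n.+1) : c i * mu i = 0.
  have := congr1 (ip (psi i)) Sv.
  rewrite empirical_sum ip0r.
  under eq_bigr do rewrite Se scalerA.
  by rewrite (ip_comb oe _ (fun i => c i * mu i)) ltn_ord.
have [i ci] : exists i : 'I_n.+1, c i != 0.
  apply: contrapT => /forallNP h; move: c0; rewrite big1 ?ltxx// => i _.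
  by have /negP := h i; rewrite negbK => /eqP ->; rewrite expr0n.
have /eqP := cmu i; rewrite mulf_eq0 (negbTE ci)/= => /eqP mui.
by apply/eqP; rewrite eq_le mu0 -mui mule// -ltnS.
Qed.

(** The residual [r] of a datum is orthogonal to the first [n] eigenvectors, so the form at [r] is
    at most [mu n * ip r r = 0]. Then every datum is orthogonal to [r], and in particular
    [ip r r = ip (y i) r = 0]. *)
Lemma empirical_eigensystem_data (mu : nat -> R) (psi : nat -> H) :
  (0 < n)%N -> eigensystem ip S mu psi ->
  (forall k, (n <= k)%N -> mu k = 0) /\ forall i, y i = proj ip psi n (y i).
Proof.
move=> n0 E; have oe := eigensystem_orthonormal E.
have muz := empirical_rank oe (eigensystem_psi E) (eigensystem_ge0 E) (eigensystem_le E).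
split=> // i; apply/eqP; rewrite -subr_eq0.
set r := _ - _.
have rperp j : (j < n)%N -> ip (psi j) r = 0 by exact: ip_sub_proj.
have : ip (S r) r <= 0.
  by apply: (le_trans (eigensystem_form_le Hip E rperp)); rewrite muz// mul0r.
move=> /(empirical_form_eq0 n0)/(_ i) yr.
by rewrite -(ip_eq0 Hip) {1}/r ipBl yr [X in _ - X]ip_proj_sub_proj// subr0.
Qed.

End empirical.

(** * Spectral theorem for the empirical covariance *)

Section spectral.
Context (R : realType) (H : completeNormedModType R) (ip : {dot H for idfun}).
Hypothesis Hip : induces_norm ip.
Hypothesis Hinf : infinite_dimensional H.
Context (n : nat) (n0 : (0 < n)%N) (y : 'I_n -> H).
Implicit Types (u v w : H) (a : R) (e : nat -> H).
Local Notation S := (empirical_covariance ip y).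

(** For systems under construction: the values of [e] from [m] on are arbitrary, as with the default
    entries of [nth]. *)
Definition orthonormal_upto e m :=
  forall i j, (i < m)%N -> (j < m)%N -> ip (e i) (e j) = (i == j)%:R.

Lemma ip_sub_proj_upto e m v j : orthonormal_upto e m -> (j < m)%N ->
  ip (e j) (v - proj ip e m v) = 0.
Proof.
move=> oe jm; rewrite ipBr ip_sumr (bigD1 (Ordinal jm))//= ipZr oe// eqxx mulr1.
rewrite big1 ?addr0 ?subrr// => i ij.
rewrite ipZr oe// (_ : (j == i) = false) ?mulr0//.
by apply: contraNF ij => /eqP ji; apply/eqP/val_inj.
Qed.

(** Finitely many vectors do not span, so some residual is nonzero and can be normalized. *)
Lemma exists_unit_orthogonal e m : orthonormal_upto e m ->
  exists f : H, ip f f = 1 /\ forall j, (j < m)%N -> ip (e j) f = 0.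
Proof.
move=> oe.
have [x xp] : exists x, x != proj ip e m x.
  apply: contrapT => /forallNP h; apply: Hinf.
  exists m, (fun i => e i) => x; exists (fun i => ip (e i) x).
  by have /negP := h x; rewrite negbK => /eqP.
pose g := x - proj ip e m x.
have g0 : 0 < `|g| by rewrite normr_gt0 subr_eq0.
exists (`|g|^-1 *: g); split=> [|j jm].
  by rewrite ipZl ipZr Hip; field; rewrite gt_eqF.
by rewrite ipZr ip_sub_proj_upto// mulr0.
Qed.

(** One step of Rayleigh deflation. With [A t] the combination [comb t] of the projected data and
    [A^T] its adjoint, [q t = |A t| ^ 2], while on the orthogonal complement of the [e j] the form
    of [n *: S] is [|A^T v| ^ 2]. A unit maximizer [a] of [q] yields the maximizer [A a / |A a|]. *)
Lemma top_eigenvector e m : orthonormal_upto e m ->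
  (forall j, (j < m)%N -> exists c, S (e j) = c *: e j) ->
  exists f : H, [/\ ip f f = 1, forall j, (j < m)%N -> ip (e j) f = 0,
    S f = ip (S f) f *: f &
    forall v, (forall j, (j < m)%N -> ip (e j) v = 0) ->
      ip (S v) v <= ip (S f) f * ip v v].
Proof.
move=> oe Se.
(* The unit sphere of ['rV_n] supplies the compactness missing in [H]: the Gram
   form [q] of the projected data [y'] has the same maximum as the form of
   [n *: S] on the orthogonal complement. *)
pose y' i := y i - proj ip e m (y i).
have y'e i j : (j < m)%N -> ip (e j) (y' i) = 0.
  by move=> jm; exact: ip_sub_proj_upto.
have y'v i v : (forall j, (j < m)%N -> ip (e j) v = 0) -> ip (y' i) v = ip (y i) v.
  move=> h; rewrite ipBl ip_suml big1 ?subr0// => j _.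
  by rewrite ipZl h ?mulr0.
pose comb (t : 'rV[R]_n) := \sum_(i < n) t ord0 i *: y' i.
pose q (t : 'rV[R]_n) := ip (comb t) (comb t).
pose sph : set 'rV[R]_n := [set t | \sum_(i < n) t ord0 i ^+ 2 = 1].
have csum (F : 'I_n -> 'rV[R]_n -> R) : (forall i, continuous (F i)) ->
    continuous (fun t => \sum_(i < n) F i t).
  by move=> cF; apply: continuous_big => //; exact: add_continuous.
have ccoord i : continuous (fun t : 'rV[R]_n => t ord0 i).
  exact: coord_continuous.
have cq : continuous q.
  rewrite (_ : q = fun t => \sum_(i < n) \sum_(j < n)
      t ord0 i * (t ord0 j * ip (y' i) (y' j))); last first.
    apply/funext => t; rewrite /q /comb ip_suml; apply: eq_bigr => i _.
    by rewrite ip_sumr; apply: eq_bigr => j _; rewrite ipZl ipZr.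
  apply: (csum) => i; apply: (csum) => j.
  have cmul (f g : 'rV[R]_n -> R) : continuous f -> continuous g ->
      continuous (fun t => f t * g t) by move=> cf cg t; exact: (cvgM (cf t) (cg t)).
  by apply: (cmul) => //; apply: (cmul) => //; exact: cst_continuous.
have [a asph amax] : exists2 a, a \in sph & forall t, t \in sph -> q t <= q a.
  apply: EVT_max_rV.
  - exists (\row_i (i == Ordinal n0)%:R); rewrite /sph/= (bigD1 (Ordinal n0))//= mxE eqxx.
    rewrite expr1n big1 ?addr0// => i /negbTE i0.
    by rewrite mxE i0 expr0n.
  - apply: (subclosed_compact _ (@rV_compact _ n (fun=> `[-1, 1]%classic : set R)
      (fun=> @segment_compact _ _ _))).
      rewrite (_ : sph = (fun t => \sum_(i < n) t ord0 i ^+ 2) @^-1` [set 1])//.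
      apply: closed_comp; last exact: closed_eq.
      move=> t _; apply: csum => i {}t.
      exact: (cvg_comp _ _ (@ccoord i t) (@exprn_continuous _ 2 _)).
    move=> t /= tsph i; rewrite /= in_itv/= -ler_norml.
    rewrite -(@ler_pXn2r _ 2)// ?nnegrE// expr1n real_normK ?num_real// -tsph.
    by rewrite (bigD1 i)//= lerDl sumr_ge0// => j _; exact: sqr_ge0.
  - exact: continuous_subspaceT.
have qle (b : 'I_n -> R) :
    ip (\sum_(i < n) b i *: y' i) (\sum_(i < n) b i *: y' i) <=
    q a * \sum_(i < n) b i ^+ 2.
  set B := \sum_(i < n) b i ^+ 2.
  have B0 : 0 <= B by apply: sumr_ge0 => i _; exact: sqr_ge0.
  have [BE|Bn0] := eqVneq B 0.
    rewrite BE mulr0 big1 ?ip0l// => i _.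
    move/eqP: BE; rewrite psumr_eq0 => [|j _]; last exact: sqr_ge0.
    move=> /allP/(_ i (mem_index_enum _)); rewrite sqrf_eq0 => /eqP ->.
    by rewrite scale0r.
  have s0 : 0 < Num.sqrt B by rewrite sqrtr_gt0 lt_neqAle eq_sym Bn0.
  have s2 : Num.sqrt B ^+ 2 = B by rewrite sqr_sqrtr.
  pose t : 'rV[R]_n := \row_i (b i / Num.sqrt B).
  have /amax : t \in sph.
    rewrite inE /sph/=; under eq_bigr do rewrite mxE expr_div_n s2.
    by rewrite -mulr_suml divff.
  have -> : \sum_(i < n) b i *: y' i = Num.sqrt B *: comb t.
    rewrite scaler_sumr; apply: eq_bigr => i _; rewrite scalerA mxE mulrCA divff ?mulr1//.
    by rewrite gt_eqF.
  rewrite ipZl ipZr mulrA -expr2 s2 mulrC => qt.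
  by rewrite ler_wpM2r.
pose c0 := q a.
have c0_ge0 : 0 <= c0 by exact: ip_ge0.
(* With [B = |A^T v| ^ 2], Cauchy-Schwarz gives [B ^ 2 = (ip (A A^T v) v) ^ 2 <= |A A^T v| ^ 2 * |v|
   ^ 2 <= c0 * B * |v| ^ 2]; one then divides by [B]. *)
have bound v : (forall j, (j < m)%N -> ip (e j) v = 0) ->
    \sum_(i < n) ip (y i) v ^+ 2 <= c0 * ip v v.
  move=> vperp; set B := \sum_(i < n) _.
  have B0 : 0 <= B by apply: sumr_ge0 => i _; exact: sqr_ge0.
  have [->|Bn0] := eqVneq B 0; first by rewrite mulr_ge0// ip_ge0.
  have Bpos : 0 < B by rewrite lt_neqAle eq_sym Bn0.
  have BE : B = ip (\sum_(i < n) ip (y i) v *: y' i) v.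
    by rewrite ip_suml; apply: eq_bigr => i _; rewrite ipZl y'v// expr2.
  rewrite -(ler_pM2l Bpos) -expr2 {1}BE.
  apply: le_trans (cauchy_schwarz Hip _ _) _.
  by rewrite mulrA ler_wpM2r ?ip_ge0// (le_trans (qle _))// mulrC.
(* A unit vector of the complement that attains the bound [c0] is an eigenvector, so the two cases
   below need only exhibit one. *)
have maxeig f : ip f f = 1 -> (forall j, (j < m)%N -> ip (e j) f = 0) ->
    c0 <= \sum_(i < n) ip (y i) f ^+ 2 ->
    [/\ ip f f = 1, forall j, (j < m)%N -> ip (e j) f = 0,
    S f = ip (S f) f *: f &
    forall v, (forall j, (j < m)%N -> ip (e j) v = 0) ->
      ip (S v) v <= ip (S f) f * ip v v].
  move=> ff fperp c0f.
  set c := ip (S f) f.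
  have nr : 0 < n%:R^-1 :> R by rewrite invr_gt0 ltr0n.
  have cE : c = n%:R^-1 * c0.
    rewrite /c empirical_form; congr (_ * _); apply/eqP.
    under eq_bigr do rewrite -expr2.
    by rewrite eq_le c0f andbT -[leRHS]mulr1 -ff bound.
  have Sle v : (forall j, (j < m)%N -> ip (e j) v = 0) -> ip (S v) v <= c * ip v v.
    move=> vperp; rewrite cE -mulrA empirical_form ler_pM2l//.
    by under eq_bigr do rewrite -expr2; exact: bound.
  split=> //.
  pose g := S f - c *: f.
  have gperp j : (j < m)%N -> ip (e j) g = 0.
    move=> jm; rewrite ipBr [X in _ - X]ipZr fperp// mulr0 subr0 ipC empirical_sym.
    by have [d ->] := Se j jm; rewrite ipZl fperp// mulr0.
  pose Q v := c * ip v v - ip (S v) v.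
  have Q0 : 0 <= Q g by rewrite subr_ge0 Sle.
  apply/eqP; rewrite -subr_eq0 -(ip_eq0 Hip) -/g.
  have gg0 := ip_ge0 Hip g.
  (* Perturbing the maximizer [f] along the defect [g = S f - c f] by [t] changes
   [Q] by [t ^ 2 * Q g - 2 * t * |g| ^ 2], negative for this [t] unless [g = 0]. *)
pose t := ip g g / (Q g + 1).
  have Q1 : 0 < Q g + 1 by rewrite ltr_wpDl.
  have ex (u v w z : H) : ip (t *: u + v) (t *: w + z) =
      t ^+ 2 * ip u w + t * ip u z + t * ip v w + ip v z.
    by rewrite !(ipDl, ipDr, ipZl, ipZr); ring.
  have h : ip (S (t *: g + f)) (t *: g + f) <= c * ip (t *: g + f) (t *: g + f).
    by apply: Sle => j jm; rewrite ipDr ipZr gperp// fperp// mulr0 addr0.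
  rewrite (_ : S (t *: g + f) = t *: S g + S f) in h; last exact: empirical_linear.
  rewrite !ex ff (ipC ip f g) (empirical_sym ip y g f) -/c in h.
  have Sfg : ip (S f) g = ip g g + c * ip g f.
    rewrite (ipC ip g f) -ipZl -ipDl; congr (ip _ g); by rewrite /g subrK.
  rewrite Sfg in h.
  have h2 : 2 * t * ip g g <= t ^+ 2 * Q g by rewrite /Q; nra.
  have [//|gn0] := eqVneq (ip g g) 0.
  have gpos : 0 < ip g g by rewrite lt_neqAle eq_sym gn0.
  have t0 : 0 < t by rewrite divr_gt0.
  have tQ : t * (Q g + 1) = ip g g by rewrite /t divfK// gt_eqF.
  by nra.
(* If all projected data vanish, then [c0 = 0] and every unit vector of the complement is a
   maximizer. *)
have [yz|] := pselect (forall i, y' i = 0).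
  have [f [ff fperp]] := exists_unit_orthogonal oe.
  exists f; apply: maxeig => //.
  rewrite /c0 /q /comb; under eq_bigr do rewrite yz scaler0.
  by rewrite big1// ip0l sumr_ge0// => i _; rewrite sqr_ge0.
move=> /existsNP[i0 /eqP yi0].
have c0_gt0 : 0 < c0.
  have := qle (fun i => (i == i0)%:R).
  rewrite (bigD1 i0)//= eqxx scale1r big1 ?addr0; last first.
    by move=> i /negbTE ->; rewrite scale0r.
  rewrite (bigD1 i0)//= eqxx expr1n big1 ?addr0; last first.
    by move=> i /negbTE ->; rewrite expr0n.
  rewrite mulr1; apply: lt_le_trans.
  by rewrite lt_neqAle ip_ge0// andbT eq_sym ip_eq0.
pose r := Num.sqrt c0.
have r0 : 0 < r by rewrite sqrtr_gt0.
have r2 : r ^+ 2 = c0 by rewrite sqr_sqrtr.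
pose f := r^-1 *: comb a.
have fperp j : (j < m)%N -> ip (e j) f = 0.
  move=> jm; rewrite ipZr ip_sumr big1 ?mulr0// => i _.
  by rewrite ipZr y'e// mulr0.
exists f; apply: maxeig => //.
  by rewrite ipZl ipZr -/(q a) -/c0 -r2; field; rewrite gt_eqF.
(* Since [\sum a_i * ip (y i) f = r] and [\sum a_i ^ 2 = 1], expanding this square gives [\sum ip (y
   i) f ^ 2 >= 2 * r ^ 2 - r ^ 2 = c0]. *)
have : 0 <= \sum_(i < n) (ip (y i) f - r * a ord0 i) ^+ 2.
  by apply: sumr_ge0 => i _; exact: sqr_ge0.
rewrite [X in 0 <= X -> _](_ : _ = \sum_(i < n) ip (y i) f ^+ 2
  - 2 * r * \sum_(i < n) a ord0 i * ip (y i) f + r ^+ 2 * \sum_(i < n) a ord0 i ^+ 2).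
  have -> : \sum_(i < n) a ord0 i * ip (y i) f = r.
    transitivity (ip (comb a) f).
      by rewrite ip_suml; apply: eq_bigr => i _; rewrite ipZl y'v.
    by rewrite ipZr -/(q a) -/c0 -r2; field; rewrite gt_eqF.
  move: asph; rewrite inE => ->; rewrite mulr1 -mulrA -expr2 r2.
  by lra.
rewrite !mulr_sumr -sumrB -big_split/=.
by apply: eq_bigr => i _; ring.
Qed.

Lemma exists_empirical_eigensystem : exists mu psi, eigensystem ip S mu psi.
Proof.
pose good (s : seq H) := orthonormal_upto (nth 0 s) (size s) /\
  forall j, (j < size s)%N -> exists c, S (nth 0 s j) = c *: nth 0 s j.
pose top (s : seq H) (f : H) := [/\ ip f f = 1,
  forall j, (j < size s)%N -> ip (nth 0 s j) f = 0, S f = ip (S f) f *: f &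
  forall v, (forall j, (j < size s)%N -> ip (nth 0 s j) v = 0) ->
      ip (S v) v <= ip (S f) f * ip v v].
(* [next] must be total, so lists that are not [good] receive the junk value 0; [goodF] shows that
   the recursion never meets one. *)
have /choice[next nextP] : forall s, exists f, good s -> top s f.
  move=> s; have [[oe Se]|ns] := pselect (good s); last by exists 0.
  by have [f topf] := top_eigenvector oe Se; exists f.
pose fix F k : seq H := if k is k'.+1 then rcons (F k') (next (F k')) else [::].
pose psi k := next (F k).
have sF k : size (F k) = k by elim: k => //= k IH; rewrite size_rcons IH.
have nF k j : (j < k)%N -> nth 0 (F k) j = psi j.
  elim: k => //= k IH; rewrite ltnS leq_eqVlt nth_rcons sF => /orP[/eqP ->|jk].
    by rewrite ltnn eqxx.
  by rewrite jk IH.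
have goodF k : good (F k).
  elim: k => [|k IH]; first by split.
  have [ff fperp Sf _] := nextP _ IH; rewrite sF -/(psi k) in ff fperp Sf.
  have fperp' j : (j < k)%N -> ip (psi j) (psi k) = 0.
    by move=> jk; rewrite -(nF k)// fperp.
  have [oe Se] := IH; rewrite /orthonormal_upto sF in oe Se.
  split=> [i j|j]; rewrite sF.
    rewrite !ltnS => ik jk; rewrite !nF ?ltnS//.
    move: ik jk; rewrite (leq_eqVlt i) (leq_eqVlt j).
    move=> /predU1P[->|ik] /predU1P[->|jk].
    - by rewrite ff eqxx.
    - by rewrite ipC fperp'// gtn_eqF.
    - by rewrite fperp'// ltn_eqF.
    - by have := oe i j ik jk; rewrite !nF.
  rewrite ltnS leq_eqVlt => /predU1P[->|jk]; rewrite nF ?ltnS ?leqnn ?(ltnW jk)//.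
    by exists (ip (S (psi k)) (psi k)); exact: Sf.
  by have := Se j jk; rewrite nF.
have topF k : [/\ ip (psi k) (psi k) = 1,
    forall j, (j < k)%N -> ip (psi j) (psi k) = 0,
    S (psi k) = ip (S (psi k)) (psi k) *: psi k &
    forall v, (forall j, (j < k)%N -> ip (psi j) v = 0) ->
      ip (S v) v <= ip (S (psi k)) (psi k) * ip v v].
  have [ff fperp Sf Sle] := nextP _ (goodF k); rewrite sF in fperp Sle; split=> //.
    by move=> j jk; rewrite -(nF k)// fperp.
  by move=> v vperp; apply: Sle => j jk; rewrite nF// vperp.
pose mu k := ip (S (psi k)) (psi k).
have oe : orthonormal_seq ip psi.
  move=> i j; have [ij|ji|->] := ltngtP i j.
  - by have [_ -> ] := topF j.
  - by rewrite ipC; have [_ -> ] := topF i.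
  - by have [-> ] := topF j.
have Se k : S (psi k) = mu k *: psi k by have [_ _ h _] := topF k.
have mu0 k : 0 <= mu k.
  rewrite /mu empirical_form mulr_ge0 ?invr_ge0// sumr_ge0// => i _.
  by rewrite -expr2 sqr_ge0.
have mule i j : (i <= j)%N -> mu j <= mu i.
  move=> ij; have [_ _ _ h] := topF i; apply: le_trans (h (psi j) _) _.
    by move=> k ki; rewrite oe ltn_eqF// (leq_trans ki).
  by have [-> _ _ _] := topF j; rewrite mulr1.
have muz := empirical_rank oe Se mu0 mule.
(* The eigenvalues vanish from index [n] on, so the series is eventually constant. Its value is
   [S v] because [S] kills the residual of [v]: the form there is at most [mu n * ip _ _ = 0]. *)
exists mu, psi; split=> // v; apply: cvg_near_cst; near=> m.
have nm : (n <= m)%N by near: m; exact: nbhs_infty_ge.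
have Sr : S (v - proj ip psi n v) = 0.
  apply: empirical_eq0; apply: empirical_form_eq0 => //.
  have [_ _ _ h] := topF n; apply: (le_trans (h _ _)).
    by move=> j jn; exact: ip_sub_proj.
  by rewrite -/(mu n) muz// mul0r.
have -> : S v = S (proj ip psi n v).
  have := empirical_linear ip y 1 (v - proj ip psi n v) (proj ip psi n v).
  by rewrite !scale1r subrK Sr add0r.
rewrite (empirical_sum _ _ n (fun i => ip (psi i) v)).
rewrite /series/= big_mkord (big_ord_widen m (fun i => ip (psi i) v *: S (psi i)))//.
rewrite [RHS]big_mkcond/=; apply: eq_bigr => j _; case: ifPn => [jn|].
  by rewrite Se /tensor !scalerA mulrC.
by rewrite -leqNgt => nj; rewrite muz// scale0r.
Unshelve. all: end_near. Qed.

End spectral.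

(** * Kernel means of Gaussian laws *)

Section fubini_bounded.
Context d1 d2 (T1 : measurableType d1) (T2 : measurableType d2) (R : realType).

Lemma Rintegral_swap (P1 : probability T1 R) (P2 : probability T2 R)
    (F : T1 * T2 -> R) (M : R) :
  measurable_fun setT F -> (forall z, `|F z| <= M) ->
  \int[P1]_x \int[P2]_y F (x, y) = \int[P2]_y \int[P1]_x F (x, y).
Proof.
move=> mF FM.
have intF : (P1 \x P2)%E.-integrable setT (EFin \o F).
  exact: (@bounded_integrable _ _ R (P1 \x P2)%E F M).
have int2 x : P2.-integrable setT (EFin \o (fun y => F (x, y))).
  apply: bounded_integrable => [|y]; last exact: FM.
  by apply: measurableT_comp.
have int1 y : P1.-integrable setT (EFin \o (fun x => F (x, y))).
  apply: bounded_integrable => [|x]; last exact: FM.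
  by apply: measurableT_comp.
rewrite /Rintegral; congr fine.
transitivity (\int[P1]_x \int[P2]_y (F (x, y))%:E)%E.
  by apply: eq_integral => x _; rewrite fineK//; exact: (integrable_fin_num measurableT (int2 x)).
rewrite (Fubini intF); apply: eq_integral => y _.
by rewrite fineK//; exact: (integrable_fin_num measurableT (int1 y)).
Qed.

End fubini_bounded.

Section gaussian_hilbert.
Context (R : realType) (H : completeNormedModType R) (ip : {dot H for idfun}).
Hypothesis Hip : induces_norm ip.
Implicit Types (u v : H) (f : R -> R).

Lemma borel_measurable_continuous (g : H -> R) :
  continuous g -> measurable_fun [set: borel H] (g : borel H -> R).
Proof.
move=> /continuousP cg; apply: (measurability _ (RGenOpens.measurableE R)).
move=> _ [_ [a [b ->] <-]]; rewrite setTI.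
by apply: sub_sigma_algebra; apply: cg; exact: interval_open.
Qed.

Lemma measurable_dist u : measurable_fun [set: borel H] (fun z : borel H => `|u - (z : H)| : R).
Proof.
apply: borel_measurable_continuous => z.
have uz : u - z' @[z' --> z] --> u - z by apply: cvgB; [exact: cvg_cst|exact: cvg_id].
exact: (cvg_comp _ _ uz (@norm_continuous _ _ _)).
Qed.

Lemma measurable_ip u : measurable_fun [set: borel H] (fun z : borel H => ip u z : R).
Proof. by apply: borel_measurable_continuous; exact: ip_continuous. Qed.

Lemma Rintegral_ip_law (mu : probability (borel H) R)
    (nu : probability (measurableTypeR R) R) u f (M : R) :
  (forall A : set R, measurable A ->
     pushforward mu (fun z : borel H => ip u z) A = nu A) ->
  measurable_fun [set: measurableTypeR R] f -> (forall x, `|f x| <= M) ->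
  \int[mu]_z f (ip u z) = \int[nu]_x f x.
Proof.
move=> law mf fM; rewrite /Rintegral; congr fine.
have mEf : measurable_fun [set: measurableTypeR R] (EFin \o f) by exact/measurable_EFinP.
have intf : mu.-integrable setT (EFin \o (fun z : borel H => f (ip u z))).
  apply: bounded_integrable => [|z]; last exact: fM.
  exact: (measurableT_comp mf (measurable_ip u)).
have h := @integral_pushforward _ _ (borel H) (measurableTypeR R) R
  (fun z : borel H => ip u z) (measurable_ip u) mu setT (EFin \o f) mEf intf measurableT.
apply: etrans (esym h) _.
apply: eq_measure_integral => [|mip A mA _]; last exact: law.
exact: measurable_ip.
Qed.

(** The law is symmetric, so [cos (c + x)] may be averaged with [cos (c - x)], which leaves
    [cos c * cos x]. *)
Lemma Rintegral_cosD_normal_prob (s c : R) : 0 < s ->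
  \int[normal_prob 0 s]_x cos (c + x) = cos c * expR (- s ^+ 2 / 2).
Proof.
move=> s0.
have mc (a b : R) : measurable_fun setT (fun x : measurableTypeR R => cos (a + b * x) : R).
  apply: continuous_measurable_fun => x.
  apply: continuous_comp; last exact: continuous_cos.
  by apply: cvgD; [exact: cvg_cst|exact: mulrl_continuous].
have intc (a b : R) : lebesgue_measure.-integrable setT
    (EFin \o (fun x : measurableTypeR R => cos (a + b * x) * normal_pdf 0 s x)).
  apply: le_integrable (integrable_normal_pdf 0 s) => //.
    by apply/measurable_EFinP; apply: measurable_funM => //; exact: measurable_normal_pdf.
  by move=> x _; rewrite /= lee_fin normrM ler_piMl//; exact: cos_max.
have cosM (a b : R) : \int[normal_prob 0 s]_x cos (a + b * x) =
    \int[lebesgue_measure]_x (cos (a + b * x) * normal_pdf 0 s x).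
  by apply: Rintegral_normal_prob (mc a b) (fun x => cos_max _).
have -> : \int[normal_prob 0 s]_x cos (c + x) = \int[normal_prob 0 s]_x cos (c + 1 * x).
  by apply: eq_Rintegral => x _; rewrite mul1r.
have refl : \int[normal_prob 0 s]_x cos (c + 1 * x) =
    \int[normal_prob 0 s]_x cos (c + -1 * x).
  have n1 : -1 != 0 :> R by rewrite oppr_eq0 oner_eq0.
  rewrite !cosM [LHS](Rintegral_affine 0 n1 (intc _ _)).
  rewrite normrN1 mul1r; apply: eq_Rintegral => x _.
  by rewrite add0r mul1r !normal_pdfE ?gt_eqF// /normal_fun !subr0 mulN1r sqrrN.
have char : \int[normal_prob 0 s]_x cos (0 + 1 * x) = expR (- s ^+ 2 / 2).
  have := @Rintegral_cos_normal_prob _ s 0 1 s0 (lexx 0).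
  rewrite mulr0 mul0r addr0 sqrtr1 invr1 mul1r mulr1 expr1n mulN1r => <-.
  by apply: eq_Rintegral => x _; rewrite add0r oppr0 mul0r expR0 mulr1.
have sum : \int[normal_prob 0 s]_x cos (c + 1 * x) + \int[normal_prob 0 s]_x cos (c + -1 * x) =
    2 * cos c * \int[normal_prob 0 s]_x cos (0 + 1 * x).
  rewrite !cosM -RintegralD// -RintegralZl//.
  apply: eq_Rintegral => x _.
  by rewrite mul1r mulN1r add0r cosB cosD; ring.
by rewrite -refl char in sum; lra.
Qed.

(** A real form of the characteristic function: the phase [c] does the work of complex exponentials
    and keeps the formula stable under products of cosines. *)
Lemma gaussian_cos (C : H -> H) (mu : probability (borel H) R) (c : R) u :
  gaussian ip 0 C mu ->
  \int[mu]_z cos (c + ip u z) = cos c * expR (- ip (C u) u / 2).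
Proof.
move=> /(_ u); rewrite ip0r => -[v0 law].
have mcos : measurable_fun setT (fun x : measurableTypeR R => cos (c + x) : R).
  apply: continuous_measurable_fun => x.
  apply: continuous_comp; last exact: continuous_cos.
  by apply: cvgD; [exact: cvg_cst|exact: cvg_id].
have cos1 x : `|cos (c + x)| <= 1 by exact: cos_max.
have [vE|vn0] := eqVneq (ip (C u) u) 0.
  rewrite (@Rintegral_ip_law mu (\d_(0 : measurableTypeR R)) u
    (fun x => cos (c + x)) 1)//; last first.
    by move=> A mA; rewrite law// /normal_law vE eqxx.
  rewrite /Rintegral integral_dirac//; last exact/measurable_EFinP.
  by rewrite diracT mul1e /= vE oppr0 mul0r expR0 mulr1 addr0.
have v_gt0 : 0 < ip (C u) u by rewrite lt_neqAle eq_sym vn0.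
rewrite (@Rintegral_ip_law mu (normal_prob 0 (Num.sqrt (ip (C u) u))) u
  (fun x => cos (c + x)) 1)//; last first.
  by move=> A mA; rewrite law// /normal_law (negbTE vn0).
by rewrite Rintegral_cosD_normal_prob ?sqrtr_gt0// sqr_sqrtr.
Qed.

(** The expectation of [expR (- sigma * (t - X) ^ 2)] for [X] of law [N(0, a)]. *)
Definition gauss_kernel (sigma a t : R) :=
  (Num.sqrt (1 + 2 * sigma * a))^-1 * expR (- sigma * t ^+ 2 / (1 + 2 * sigma * a)).

(** The spectral measure of the Gaussian kernel is [N(0, 2 * sigma)], whose characteristic function
    at [x] is [expR (- 2 * sigma * x ^ 2 / 2)]. *)
Lemma expR_sqr_mixture (sigma x : R) : 0 < sigma ->
  expR (- sigma * x ^+ 2) =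
  \int[normal_prob 0 (Num.sqrt (2 * sigma))]_xi cos (x * xi).
Proof.
move=> s0.
have q0 : 0 < Num.sqrt (2 * sigma) by rewrite sqrtr_gt0 mulr_gt0.
transitivity (\int[normal_prob 0 (Num.sqrt (2 * sigma))]_xi
    (cos (x * xi) * expR (- 0 * xi ^+ 2))).
  rewrite Rintegral_cos_normal_prob// mulr0 mul0r addr0 sqrtr1 invr1 mul1r mulr1.
  by congr expR; rewrite sqr_sqrtr ?mulr_ge0 ?ltW//; field.
by apply: eq_Rintegral => xi _; rewrite oppr0 mul0r expR0 mulr1.
Qed.

(** [gauss_kernel] on the frequency side: [expR (- (a / 2) * xi ^ 2)] is the characteristic function
    of [N(0, a)], the result of integrating out the coordinate under the mixture. *)
Lemma gauss_kernelE (sigma a t : R) : 0 < sigma -> 0 <= a ->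
  gauss_kernel sigma a t =
  \int[normal_prob 0 (Num.sqrt (2 * sigma))]_xi
    (cos (t * xi) * expR (- (a / 2) * xi ^+ 2)).
Proof.
move=> s0 a0.
have q0 : 0 < Num.sqrt (2 * sigma) by rewrite sqrtr_gt0 mulr_gt0.
rewrite Rintegral_cos_normal_prob//; last by rewrite divr_ge0.
rewrite sqr_sqrtr ?mulr_ge0 ?(ltW s0)//.
have -> : 1 + 2 * (a / 2) * (2 * sigma) = 1 + 2 * sigma * a by field.
have D0 : 0 < 1 + 2 * sigma * a by rewrite ltr_wpDr// !mulr_ge0// ltW.
rewrite /gauss_kernel; congr (_ * expR _); field.
by rewrite gt_eqF.
Qed.

Section gaussian_product.
Variables (C : H -> H) (mu : probability (borel H) R) (sigma : R).
Hypothesis Clin : forall a u v, C (a *: u + v) = a *: C u + C v.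
Hypothesis Csym : forall u v, ip (C u) v = ip (C v) u.
Hypothesis Cmu : gaussian ip 0 C mu.
Hypothesis sigma0 : 0 < sigma.

Local Notation N := (normal_prob 0 (Num.sqrt (2 * sigma))).

(* The cosine factor makes the induction on [m] go through: the last kernel factor
   is turned into a cosine mixture and absorbed. *)
Lemma gaussian_product (e : nat -> H) (t : nat -> R) m c u :
  (forall i j, (i < m)%N -> (j < m)%N -> i != j -> ip (C (e i)) (e j) = 0) ->
  (forall i, (i < m)%N -> ip (C u) (e i) = 0) ->
  \int[mu]_z ((\prod_(k < m) expR (- sigma * (t k - ip (e k) z) ^+ 2)) *
     cos (c + ip u z)) =
  (\prod_(k < m) gauss_kernel sigma (ip (C (e k)) (e k)) (t k)) *
  (cos c * expR (- ip (C u) u / 2)).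
Proof.
elim: m c u => [|m IH] c u eperp uperp.
  rewrite big_ord0 mul1r -(gaussian_cos c u Cmu).
  by apply: eq_Rintegral => z _; rewrite big_ord0 mul1r.
have eperp' i j : (i < m)%N -> (j < m)%N -> i != j -> ip (C (e i)) (e j) = 0.
  by move=> im jm; apply: eperp; rewrite ltnS ltnW.
pose a := ip (C (e m)) (e m).
have a0 : 0 <= a by have [] := Cmu (e m).
pose P z := \prod_(k < m) expR (- sigma * (t k - ip (e k) z) ^+ 2).
(* Product-to-sum turns the two cosines into cosines of single functionals. The new directions, [u]
   shifted by a multiple of [e m], are still orthogonal for [C] to the earlier [e i], so the
   induction hypothesis applies to each. *)
have mu_xi z xi : P z * (cos (c + ip u z) * cos ((t m - ip (e m) z) * xi)) =
    2^-1 * (P z * cos (c + xi * t m + ip ((- xi) *: e m + u) z)) +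
    2^-1 * (P z * cos (c - xi * t m + ip (xi *: e m + u) z)).
  rewrite !(ipDl, ipZl).
  have -> : c + xi * t m + (- xi * ip (e m) z + ip u z) =
    (c + ip u z) + (t m - ip (e m) z) * xi by ring.
  have -> : c - xi * t m + (xi * ip (e m) z + ip u z) =
    (c + ip u z) - (t m - ip (e m) z) * xi by ring.
  by move: (c + ip u z) (_ * xi) => w A; rewrite cosD cosB; field.
have P0 z : 0 <= P z by rewrite prodr_ge0// => i _; exact: expR_ge0.
have P1 z : P z <= 1.
  rewrite prodr_ile1// => i _; rewrite expR_ge0/= -expR0 ler_expR.
  by rewrite mulNr oppr_le0 mulr_ge0 ?sqr_ge0// ltW.
have mP : measurable_fun setT (P : borel H -> R).
  apply: measurable_prod => k _; apply: measurableT_comp => //.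
  apply: measurable_funM => //; apply: measurable_funX; apply: measurable_funB => //.
  exact: measurable_ip.
have mcosR : measurable_fun setT (cos : measurableTypeR R -> R).
  by apply: continuous_measurable_fun => x; exact: continuous_cos.
have mcos c' v : measurable_fun setT (fun z : borel H => cos (c' + ip v z) : R).
  apply: (measurableT_comp mcosR); apply: measurable_funD => //.
  exact: measurable_ip.
pose F (z : borel H * measurableTypeR R) : R :=
  P z.1 * (cos (c + ip u z.1) * cos ((t m - ip (e m) z.1) * z.2)).
have mF : measurable_fun setT F.
  apply: measurable_funM; first exact: (measurableT_comp mP measurable_fst).
  apply: measurable_funM; first exact: (measurableT_comp (mcos c u) measurable_fst).
  apply: (measurableT_comp mcosR); apply: measurable_funM => //.
  apply: measurable_funB => //; exact: (measurableT_comp (measurable_ip (e m)) measurable_fst).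
have mxi s : measurable_fun setT (fun xi : measurableTypeR R => cos (s * xi) : R).
  by apply: (measurableT_comp mcosR); apply: measurable_funM.
have intxi s : N.-integrable setT (EFin \o (fun xi : measurableTypeR R => cos (s * xi))).
  by apply: (@bounded_integrable _ _ _ _ _ 1) => // xi; exact: cos_max.
have F1 z : `|F z| <= 1.
  rewrite /F normrM (ger0_norm (P0 _)) mulr_ile1//.
  by rewrite normrM mulr_ile1 ?normr_ge0// cos_max.
have intP c' v : mu.-integrable setT (EFin \o (fun z : borel H => P z * cos (c' + ip v z))).
  apply: (@bounded_integrable _ _ _ _ _ 1); first exact: measurable_funM.
  by move=> z; rewrite normrM (ger0_norm (P0 _)) mulr_ile1 ?normr_ge0// cos_max.
transitivity (\int[mu]_z \int[N]_xi F (z, xi)).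
  apply: eq_Rintegral => z _; rewrite big_ord_recr/= -/(P z).
  rewrite expR_sqr_mixture// -mulrA mulrC -RintegralZr//.
  rewrite mulrC -RintegralZl//; last first.
    apply: (@bounded_integrable _ _ _ _ _ 1); first exact: measurable_funM.
    by move=> xi; rewrite normrM mulr_ile1 ?normr_ge0 ?cos_max.
  by apply: eq_Rintegral => xi _; rewrite /F/= [X in _ * X]mulrC.
rewrite (@Rintegral_swap _ _ (borel H) (measurableTypeR R) R mu N F 1)//.
rewrite big_ord_recr/= (gauss_kernelE _ sigma0 a0) -/a.
set G := \prod_(k < m) _.
transitivity (\int[N]_xi (G * (cos c * expR (- ip (C u) u / 2)) *
    (cos (t m * xi) * expR (- (a / 2) * xi ^+ 2)))); last first.
  rewrite RintegralZl//; last first.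
    apply: (@bounded_integrable _ _ _ _ _ 1).
      apply: measurable_funM => //; apply: measurableT_comp => //.
      by apply: measurable_funM => //; exact: measurable_funX.
    move=> xi; rewrite normrM mulr_ile1 ?normr_ge0 ?cos_max// ger0_norm ?expR_ge0//.
    by rewrite -expR0 ler_expR mulNr oppr_le0 mulr_ge0 ?sqr_ge0 ?divr_ge0.
  by rewrite -/a; ring.
apply: eq_Rintegral => xi _.
transitivity (\int[mu]_z (2^-1 * (P z * cos (c + xi * t m + ip ((- xi) *: e m + u) z)) +
    2^-1 * (P z * cos (c - xi * t m + ip (xi *: e m + u) z)))).
  by apply: eq_Rintegral => z _; rewrite /F /= mu_xi.
rewrite RintegralD//; last 2 first.
- exact: (integrableZl measurableT 2^-1 (intP (c + xi * t m) (- xi *: e m + u))).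
- exact: (integrableZl measurableT 2^-1 (intP (c - xi * t m) (xi *: e m + u))).
rewrite !RintegralZl//.
have Cxi x i : (i < m)%N -> ip (C (x *: e m + u)) (e i) = 0.
  move=> im; rewrite Clin ipDl ipZl uperp ?ltnS 1?ltnW// eperp ?ltnS ?(ltnW im)//.
    by rewrite mulr0 addr0.
  by rewrite gtn_eqF.
have Qxi x : ip (C (x *: e m + u)) (x *: e m + u) = x ^+ 2 * a + ip (C u) u.
  rewrite Clin !(ipDl, ipDr, ipZl, ipZr) (Csym (e m) u) uperp ?ltnSn//.
  by rewrite -/a; ring.
rewrite !IH//; [|exact: Cxi..].
(* The variance is even in [xi], so both halves carry the same exponential, and the two shifted
   cosines add up to [2 * cos c * cos (xi * t m)]. *)
rewrite !Qxi sqrrN -/G cosD cosB.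
have -> : - (xi ^+ 2 * a + ip (C u) u) / 2 = - (a / 2) * xi ^+ 2 + - ip (C u) u / 2 by field.
by rewrite expRD (mulrC xi); field.
Qed.

End gaussian_product.

End gaussian_hilbert.

Section positive_integral.
Context d (T : measurableType d) (R : realType).

Lemma Rintegral_gt0 (P : probability T R) (f : T -> R) (M : R) :
  measurable_fun setT f -> (forall x, 0 < f x) -> (forall x, f x <= M) ->
  0 < \int[P]_x f x.
Proof.
move=> mf f0 fM.
have intf : P.-integrable setT (EFin \o f).
  by apply: (@bounded_integrable _ _ _ _ _ M) => // x; rewrite gtr0_norm.
rewrite lt_neqAle Rintegral_ge0 ?andbT => [|x _]; last exact: ltW.
apply/negP => /eqP/esym I0.
have : (\int[P]_x `|(EFin \o f) x| = 0)%E.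
  under eq_integral do rewrite /= gtr0_norm//.
  have fin := integrable_fin_num measurableT intf.
  by rewrite -[LHS]fineK// -/(Rintegral P setT f) I0.
move/(ae_eq_integral_abs P measurableT (measurable_int _ intf)) => -[N [mN N0 sub]].
have NT : N = setT.
  apply/seteqP; split=> // x _; apply: sub => /= /(_ I) [fx0].
  by have := f0 x; rewrite fx0 ltxx.
have PN : P N = 1%E by rewrite NT; exact: probability_setT.
by have /eqP := etrans (esym N0) PN; rewrite eq_sym onee_eq0.
Qed.

End positive_integral.

(** * Bounds at a single observation *)

Section kernel_bound.
Context (R : realType) (H : completeNormedModType R) (ip : {dot H for idfun}).
Hypothesis Hip : induces_norm ip.
Implicit Types (u v y : H).

Definition kernel_at (sigma : R) (mu : probability (borel H) R) y : R :=
  \int[mu]_z expR (- sigma * `|y - (z : H)| ^+ 2).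

Lemma measurable_kernel (sigma : R) y :
  measurable_fun setT (fun z : borel H => expR (- sigma * `|y - (z : H)| ^+ 2) : R).
Proof.
apply: measurableT_comp => //; apply: measurable_funM => //; apply: measurable_funX.
exact: measurable_dist.
Qed.

Lemma kernel_le1 (sigma : R) (x : R) : 0 < sigma -> expR (- sigma * x ^+ 2) <= 1.
Proof.
move=> s0; rewrite -expR0 ler_expR mulNr oppr_le0 mulr_ge0 ?sqr_ge0//.
exact: ltW.
Qed.

Lemma kernel_at_gt0 (sigma : R) (mu : probability (borel H) R) y :
  0 < sigma -> 0 < kernel_at sigma mu y.
Proof.
move=> s0; apply: (@Rintegral_gt0 _ (borel H) R mu _ 1).
- exact: measurable_kernel.
- by move=> z; exact: expR_gt0.
- by move=> z; exact: kernel_le1.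
Qed.

Section eigen.
Variables (C : H -> H) (lam : nat -> R) (psi : nat -> H).
Variables (mu : probability (borel H) R) (sigma : R).
Hypothesis E : eigensystem ip C lam psi.
Hypothesis Cmu : gaussian ip 0 C mu.
Hypothesis sigma0 : 0 < sigma.

(* The characteristic function at [psi n] is [expR (- lam n / 2)], and
   [ip (psi n) z] tends to 0 for every [z]. *)
Lemma gaussian_eigenvalues_cvg0 : lam n @[n --> \oo] --> (0 : R).
Proof.
have oe := eigensystem_orthonormal E.
have cosE n : \int[mu]_z cos (ip (psi n) z) = expR (- lam n / 2).
  transitivity (\int[mu]_z cos (0 + ip (psi n) z)).
    by apply: eq_Rintegral => z _; rewrite add0r.
  rewrite (gaussian_cos Hip _ _ Cmu) cos0 mul1r (eigensystem_psi E) ipZl oe eqxx.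
  by rewrite mulr1.
have mcos n : measurable_fun setT (fun z : borel H => (cos (ip (psi n) z))%:E : \bar R).
  apply/measurable_EFinP; apply: (measurableT_comp _ (measurable_ip Hip (psi n))).
  by apply: continuous_measurable_fun => x; exact: continuous_cos.
have cvg1 (z : borel H) : cos (ip (psi n) z) @[n --> \oo] --> (1 : R).
  rewrite -cos0.
  exact: (cvg_comp _ _ (@ip_orthonormal_cvg0 R H ip Hip psi oe z) (@continuous_cos R 0)).
have cvgE : {ae mu, forall z : borel H, setT z ->
    (cos (ip (psi n) z))%:E @[n --> \oo] --> (1 : R)%:E}.
  by apply: aeW => z _; apply: cvg_EFin; [exact: nearW|exact: cvg1].
have domE : {ae mu, forall (z : borel H) n, setT z -> (`|(cos (ip (psi n) z))%:E| <= 1%:E)%E}.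
  by apply: aeW => z n _; rewrite /= lee_fin; exact: cos_max.
have [_ _ dom] := @dominated_convergence _ (borel H) R mu setT measurableT
  (fun n z => (cos (ip (psi n) z))%:E) (cst 1%:E) (cst 1%:E) mcos
  (measurable_cst _) cvgE (finite_measure_integrable_cst mu 1 measurableT) domE.
have exp1 : expR (- lam n / 2) @[n --> \oo] --> (1 : R).
  have mu1 : (\int[mu]_z (cst 1%:E z) = 1%:E)%E.
    by rewrite integral_cst// mul1e; exact: probability_setT.
  rewrite mu1 in dom.
  rewrite (_ : (fun n => _) =
      fine \o (fun n => (\int[mu]_z (cos (ip (psi n) z))%:E)%E)); first exact: fine_cvg.
  by apply/funext => n; rewrite -cosE.
have ln0 : ln (expR (- lam n / 2)) @[n --> \oo] --> (0 : R).
  rewrite -(@ln1 R).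
  exact: (cvg_comp _ _ exp1 (continuous_ln ltr01)).
have : (-2) * ln (expR (- lam n / 2)) @[n --> \oo] --> (-2 * 0 : R).
  by apply: cvgM; [exact: cvg_cst|exact: ln0].
rewrite mulr0 => h; apply: (cvg_trans _ h); apply: near_eq_cvg; apply: nearW => n.
by rewrite expRK; field.
Qed.

(** The squared distance is at least the sum of the squared coordinates along
    [psi_0, ..., psi_(m-1)] and the normalized residual [f] of [y], which lowers the exponent to
    something [gaussian_product] evaluates. These directions are orthogonal for [C], and the
    variance along [f] is at most [lam m]. *)
Lemma kernel_at_le m y :
  kernel_at sigma mu y <=
  (\prod_(j < m) gauss_kernel sigma (lam j) (ip (psi j) y)) *
  expR (- sigma * (ip y y - \sum_(j < m) ip (psi j) y ^+ 2) / (1 + 2 * sigma * lam m)).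
Proof.
have oe := eigensystem_orthonormal E.
have lam0 := eigensystem_ge0 E.
pose r := y - proj ip psi m y.
have rr : ip r r = ip y y - \sum_(j < m) ip (psi j) y ^+ 2 by exact: norm_sub_proj.
have psir j : (j < m)%N -> ip (psi j) r = 0 by exact: ip_sub_proj.
(* If [r = 0], then [f = 0], which satisfies all that is needed below. *)
pose f := `|r|^-1 *: r.
have psif j : (j < m)%N -> ip (psi j) f = 0 by move=> jm; rewrite ipZr psir ?mulr0.
have ff1 : ip f f <= 1.
  rewrite ipZl ipZr Hip; have [->|r0] := eqVneq `|r| 0; first by rewrite invr0 mul0r.
  by rewrite expr2 mulKf ?mulVf.
have fy : ip f y = `|r|.
  have ry : ip r y = `|r| ^+ 2.
    rewrite -Hip -[in LHS](subrK (proj ip psi m y) y) -/r ipDr [X in _ + X = _]ipC.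
    by rewrite ip_proj_sub_proj// addr0.
  rewrite ipZl ry; have [->|r0] := eqVneq `|r| 0; first by rewrite expr0n mulr0.
  by rewrite expr2 mulKf.
pose e k := if (k < m)%N then psi k else f.
pose t k := if (k < m)%N then ip (psi k) y else `|r|.
have em : e m = f by rewrite /e ltnn.
have tm : t m = `|r| by rewrite /t ltnn.
have ek k : (k < m)%N -> e k = psi k by rewrite /e => ->.
have tk k : (k < m)%N -> t k = ip (psi k) y by rewrite /t => ->.
have eperp i j : (i < m.+1)%N -> (j < m.+1)%N -> i != j -> ip (C (e i)) (e j) = 0.
  rewrite !ltnS (leq_eqVlt i) (leq_eqVlt j) => /predU1P[->|im] /predU1P[->|jm].
  - by rewrite eqxx.
  - by rewrite em ek// (eigensystem_sym Hip E) (eigensystem_psi E) ipZl psif// mulr0.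
  - by rewrite em ek// (eigensystem_psi E) ipZl psif// mulr0.
  - move=> ij; rewrite !ek// (eigensystem_psi E) ipZl oe (negbTE ij) mulr0//.
have zperp i : (i < m.+1)%N -> ip (C 0) (e i) = 0.
  by move=> _; rewrite (eigensystem_sym Hip E) ip0r.
have := gaussian_product Hip (eigensystem_linear E) (eigensystem_sym Hip E) Cmu sigma0
  t 0 eperp zperp.
rewrite cos0 mul1r ip0r oppr0 mul0r expR0 mulr1 big_ord_recr/= em tm.
move=> prodE.
have a0 : 0 <= ip (C f) f by have [] := Cmu f.
have alam : ip (C f) f <= lam m.
  apply: (le_trans (eigensystem_form_le Hip E psif)).
  by rewrite ler_piMr.
have mprod : measurable_fun setT
    (fun z : borel H => \prod_(k < m.+1) expR (- sigma * (t k - ip (e k) z) ^+ 2) : R).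
  apply: measurable_prod => k _; apply: measurableT_comp => //.
  apply: measurable_funM => //; apply: measurable_funX; apply: measurable_funB => //.
  exact: measurable_ip.
have prod0 z : 0 <= \prod_(k < m.+1) expR (- sigma * (t k - ip (e k) z) ^+ 2).
  by apply: prodr_ge0 => k _; exact: expR_ge0.
apply: (@le_trans _ _ (\int[mu]_z (
    (\prod_(k < m.+1) expR (- sigma * (t k - ip (e k) z) ^+ 2)) * cos (0 + ip 0 z)))).
  apply: le_Rintegral => //.
  - apply: (@bounded_integrable _ _ _ _ _ 1); first exact: measurable_kernel.
    by move=> z; rewrite ger0_norm ?expR_ge0//; exact: kernel_le1.
  - rewrite (_ : (fun z : borel H => _) =
        (fun z : borel H => \prod_(k < m.+1) expR (- sigma * (t k - ip (e k) z) ^+ 2))).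
      apply: (@bounded_integrable _ _ _ _ _ 1) => // z.
      rewrite ger0_norm// prodr_ile1// => k _.
      by rewrite expR_ge0/= kernel_le1.
    by apply/funext => z; rewrite ip0l addr0 cos0 mulr1.
  - move=> z _; rewrite ip0l addr0 cos0 mulr1 -expR_sum ler_expR -mulr_sumr.
    rewrite !mulNr lerN2 ler_wpM2l ?(ltW sigma0)//.
    rewrite big_ord_recr/= em tm -fy -ipBr -Hip.
    under eq_bigr => k _ do rewrite ek// tk// -ipBr.
    move: (y - (z : H)) => x.
    rewrite -lerBrDl -(norm_sub_proj oe).
    (* [f] sees only the part of [x] orthogonal to the [psi_k], so its squared coordinate fits into
       what the first [m] coordinates leave over. *)
    have fx : ip f x = ip f (x - proj ip psi m x).
      by rewrite ipBr ip_sumr big1 ?subr0// => k _; rewrite ipZr [ip f _]ipC psif ?mulr0.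
    rewrite fx; apply: (le_trans (cauchy_schwarz Hip _ _)).
    by rewrite ler_piMl// ip_ge0.
rewrite prodE.
rewrite (_ : \prod_(k < m) _ = \prod_(j < m) gauss_kernel sigma (lam j) (ip (psi j) y)); last first.
  apply: eq_bigr => k _; rewrite ek// tk// (eigensystem_psi E) ipZl oe eqxx mulr1//.
have D0 a : 0 <= a -> 0 < 1 + 2 * sigma * a.
  by move=> a0'; rewrite ltr_wpDr// !mulr_ge0// ltW.
rewrite ler_wpM2l//.
  by apply: prodr_ge0 => k _; rewrite mulr_ge0 ?expR_ge0// invr_ge0 sqrtr_ge0.
rewrite /gauss_kernel -rr Hip.
(* The square-root factor of the residual direction is at most 1 and is dropped; [optimality_gap]
   later accounts for the missing logarithm. *)
apply: (@le_trans _ _ (expR (- sigma * `|r| ^+ 2 / (1 + 2 * sigma * ip (C f) f)))).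
  rewrite ler_piMl ?expR_ge0// invf_le1 ?sqrtr_gt0 ?D0//.
  by rewrite -[leLHS]sqrtr1 ler_wsqrtr// lerDl !mulr_ge0// ltW.
rewrite ler_expR !mulNr lerN2 ler_wpM2l ?mulr_ge0 ?sqr_ge0 ?(ltW sigma0)//.
rewrite lef_pV2 ?posrE ?D0//.
by rewrite lerD2l ler_wpM2l// mulr_ge0// ltW.
Qed.

End eigen.

End kernel_bound.

(** * Factorization of the kernel mean over the observations *)

Section product_bounded.
Context d1 d2 (T1 : measurableType d1) (T2 : measurableType d2) (R : realType).

Lemma Rintegral_productM (P1 : probability T1 R) (P2 : probability T2 R)
    (f : T1 -> R) (g : T2 -> R) :
  measurable_fun setT f -> measurable_fun setT g ->
  (forall x, 0 <= f x <= 1) -> (forall y, 0 <= g y <= 1) ->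
  \int[(P1 \x P2)%E]_z (f z.1 * g z.2) = (\int[P1]_x f x) * (\int[P2]_y g y).
Proof.
move=> mf mg f01 g01.
have mF : measurable_fun setT (fun z : T1 * T2 => f z.1 * g z.2).
  by apply: measurable_funM; [exact: (measurableT_comp mf measurable_fst)|
    exact: (measurableT_comp mg measurable_snd)].
have normf x : `|f x| <= 1 by have /andP[f0 f1] := f01 x; rewrite ger0_norm.
have normg x : `|g x| <= 1 by have /andP[g0 g1] := g01 x; rewrite ger0_norm.
have intF : (P1 \x P2)%E.-integrable setT (EFin \o (fun z : T1 * T2 => f z.1 * g z.2)).
  apply: (@bounded_integrable _ _ R (P1 \x P2)%E _ 1) => // z.
  by rewrite normrM mulr_ile1.
have intf : P1.-integrable setT (EFin \o f) by exact: bounded_integrable normf.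
have intg : P2.-integrable setT (EFin \o g) by exact: bounded_integrable normg.
rewrite -RintegralZr// /Rintegral; congr fine.
rewrite -(integral12_prod_meas1 intF); apply: eq_integral => x _.
transitivity (\int[P2]_y ((f x)%:E * (g y)%:E))%E; first by [].
rewrite integralZl// EFinM fineK//; exact: (integrable_fin_num measurableT intg).
Qed.

End product_bounded.

Section kernel_mean_product.
Context (R : realType) (H : completeNormedModType R).

Lemma kernel_mean_prod n (sigma : R) (mu : probability (borel H) R) (y : 'I_n -> H) :
  0 < sigma -> kernel_mean sigma mu y = \prod_(i < n) kernel_at sigma mu (y i).
Proof.
move=> s0; elim: n y => [|n IH] y.
  rewrite big_ord0 /kernel_mean /=.
  under eq_Rintegral do rewrite big_ord0 mulr0 expR0.
  rewrite /Rintegral integral_cst// mul1e.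
  by rewrite [X in fine X](probability_setT (power_measure mu 0)).
rewrite big_ord_recl -(IH (fun i => y (lift ord0 i))).
pose f (z : borel H) := expR (- sigma * `|y ord0 - (z : H)| ^+ 2).
pose g (w : n.-tuple (borel H)) :=
  expR (- sigma * \sum_(i < n) `|y (lift ord0 i) - (tnth w i : H)| ^+ 2).
have mf : measurable_fun setT f by exact: measurable_kernel.
have msum k (v : 'I_k -> H) : measurable_fun setT (fun w : k.-tuple (borel H) =>
    expR (- sigma * \sum_(i < k) `|v i - (tnth w i : H)| ^+ 2) : R).
  apply: measurableT_comp => //; apply: measurable_funM => //.
  apply: measurable_sum => i; apply: measurable_funX.
  exact: (measurableT_comp (measurable_dist (v i)) (measurable_tnth i)).
have f01 x : 0 <= f x <= 1 by rewrite expR_ge0/= kernel_le1.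
have sum01 k (v : 'I_k -> H) (w : k.-tuple (borel H)) :
    0 <= expR (- sigma * \sum_(i < k) `|v i - (tnth w i : H)| ^+ 2) <= 1.
  rewrite expR_ge0/= -expR0 ler_expR mulNr oppr_le0 mulr_ge0 ?(ltW s0)//.
  by apply: sumr_ge0 => i _; exact: sqr_ge0.
rewrite /kernel_mean /kernel_at -/f.
rewrite -(@Rintegral_productM _ _ (borel H) _ R mu (power_measure mu n) f g)//; last 2 first.
- exact: msum.
- by move=> w; exact: sum01.
rewrite /Rintegral; congr fine.
rewrite [power_measure mu n.+1]/=.
rewrite ge0_integral_distribution//; last first.
  by apply/measurable_EFinP; exact: msum.
apply: eq_integral => -[z w] _ /=; congr EFin.
rewrite /f /g -expRD -mulrDr; congr (expR (_ * _)).
rewrite big_ord_recl; congr (_ + _).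
by apply: eq_bigr => i _; rewrite /tuple_cons /= tnthS.
Qed.

End kernel_mean_product.

(** * Gaussian laws of finite rank *)

Section separable_measurability.
Context (R : realType) (H : completeNormedModType R).
Hypothesis Hsep : separable_space H.

(* Without separability, addition on [H] may fail to be measurable for the product
   of the Borel sigma-algebras. *)
Lemma borel_measurable_dist d (T : measurableType d) (f : T -> H) :
  (forall c : H, measurable_fun setT (fun x => `|c - f x| : R)) ->
  measurable_fun setT (f : T -> borel H).
Proof.
move=> mdist.
have [D cD dD] := Hsep.
have [g gD] : exists g : nat -> H, D `<=` range g.
  have /pfcard_geP[->|[g]] := cD; first by exists (fun=> 0) => x.
  by exists g => x Dx; have /(_ x Dx)[n _ <-] := 'surj_g; exists n.
have mball c n : measurable (f @^-1` [set z | `|c - z| < n.+1%:R^-1]).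
  have := mdist c measurableT `]-oo, n.+1%:R^-1[%classic.
  rewrite setTI (_ : _ @^-1` _ = f @^-1` [set z | `|c - z| < n.+1%:R^-1]).
    by apply; exact: measurable_itv.
  by apply/seteqP; split=> x /=; rewrite in_itv.
apply: (@measurability _ _ T (borel H) setT f (@open H) erefl) => _ [U oU <-]; rewrite setTI.
pose I := [set p : nat * nat | [set z | `|g p.1 - z| < p.2.+1%:R^-1] `<=` U].
have -> : f @^-1` U = \bigcup_i \bigcup_(n in [set n | I (i, n)])
    f @^-1` [set z | `|g i - z| < n.+1%:R^-1].
  apply/seteqP; split=> [x /= Ux|x [i _ [n /= Iin fx]]]; last exact: Iin.
  have /nbhs_ballP[e /= e0 eU] : nbhs (f x) U by exact: open_nbhs_nbhs.
  have e20 : 0 < e / 2 by rewrite divr_gt0.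
  have [n n2] : exists n, n.+1%:R^-1 < e / 2.
    by have [n _ h] := near_infty_natSinv_lt (PosNum e20); exists n; exact: (h n (leqnn n)).
  have n0 : 0 < n.+1%:R^-1 :> R by rewrite invr_gt0.
  have [z [zball Dz]] : ball (f x) n.+1%:R^-1 `&` D !=set0.
    by apply: dD; [exists (f x); exact: ballxx|exact: ball_open].
  rewrite -ball_normE /ball_/= in zball.
  have [i _ gi] := gD z Dz.
  exists i => //; exists n => /=; last by rewrite gi distrC.
  move=> w /=; rewrite gi => zw; apply: eU; rewrite -ball_normE /ball_/=.
  rewrite (le_lt_trans (ler_distD z _ _))//.
  by rewrite (splitr e) ltrD// (lt_trans _ n2).
by apply: bigcupT_measurable => i; apply: bigcup_measurable => n _; exact: mball.
Qed.

End separable_measurability.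

Section gaussian_construction.
Context (R : realType) (H : completeNormedModType R) (ip : {dot H for idfun}).
Hypothesis Hip : induces_norm ip.
Hypothesis Hsep : separable_space H.

Local Notation N := (normal_prob (0 : R) 1).

Definition add_scaled (w : H) (p : borel H * measurableTypeR R) : borel H :=
  (p.1 : H) + p.2 *: w.

(** The distance from [c] to [z + x *: w] expands into real functions of [z] and of [x] that are
    separately measurable, which avoids measurability of addition on [H]. *)
Lemma measurable_add_scaled (w : H) : measurable_fun setT (add_scaled w).
Proof.
apply: borel_measurable_dist => // c.
rewrite (_ : (fun x => _) = (fun p : borel H * measurableTypeR R => Num.sqrt
  (`|c - (p.1 : H)| ^+ 2 + (p.2 ^+ 2 * `|w| ^+ 2 - 2 * p.2 * (ip w c - ip w p.1))))); last first.
  apply/funext => -[z x] /=; rewrite -[LHS]ger0_norm// -sqrtr_sqr; congr Num.sqrt.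
  rewrite -!Hip /add_scaled opprD addrA; move: (c - z) (ipBr ip w c z) => v <-.
  rewrite !(ipBl, ipBr, ipZl, ipZr) (ipC ip v w) /=; ring.
apply: (measurableT_comp (f := (Num.sqrt : measurableTypeR R -> R))).
  by apply: continuous_measurable_fun; exact: sqrt_continuous.
apply: measurable_funD.
  by apply: measurable_funX; exact: (measurableT_comp (measurable_dist c) measurable_fst).
apply: measurable_funB.
  by apply: measurable_funM => //; exact: measurable_funX.
apply: measurable_funM; first exact: measurable_funM.
apply: measurable_funB => //.
exact: (measurableT_comp (measurable_ip Hip w) measurable_fst).
Qed.

HB.instance Definition _ (w : H) := isMeasurableFun.Build _ _ _ _
  (add_scaled w) (measurable_add_scaled w).

Lemma normal_lawD (v b : R) (A : set R) : 0 <= v -> measurable A ->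
  b != 0 -> forall nu : probability (measurableTypeR R) R,
  (forall B : set R, measurable B -> nu B = normal_law 0 v B) ->
  (\int[nu]_u normal_prob u `|b| A = normal_law 0 (v + b ^+ 2) A)%E.
Proof.
move=> v0 mA b0 nu nuE.
have b2 : 0 < b ^+ 2 by rewrite exprn_even_gt0.
have nb : 0 < `|b| by rewrite normr_gt0.
have mh := measurable_normal_prob_mean nb mA.
rewrite [RHS]/normal_law gt_eqF ?ltr_wpDl//.
have [vE|vn0] := eqVneq v 0.
  rewrite (eq_measure_integral (\d_(0 : measurableTypeR R))); last first.
    by move=> B mB _; apply: etrans (nuE B mB) _; rewrite /normal_law vE eqxx.
  by rewrite integral_dirac// diracT mul1e vE add0r sqrtr_sqr.
have vpos : 0 < v by rewrite lt_neqAle eq_sym vn0.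
rewrite (eq_measure_integral (normal_prob 0 (Num.sqrt v))); last first.
  by move=> B mB _; apply: etrans (nuE B mB) _; rewrite /normal_law (negbTE vn0).
have sv : 0 < Num.sqrt v by rewrite sqrtr_gt0.
apply: (etrans (normal_prob_convolution sv nb mA)).
have -> : Num.sqrt v ^+ 2 + `|b| ^+ 2 = v + b ^+ 2.
  by rewrite sqr_sqrtr// real_normK ?num_real.
reflexivity.
Qed.

(** [mu'] is the law of [z + x *: w] with [x] standard normal and independent of [z]. The second
    clause transports sets of full measure, to keep track of where the law lives. *)
Lemma gaussian_add (C : H -> H) (mu : probability (borel H) R) (w : H) :
  gaussian ip 0 C mu ->
  exists mu' : probability (borel H) R,
    gaussian ip 0 (fun v => C v + ip w v *: w) mu' /\
    forall A B : set (borel H), measurable A -> measurable B ->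
      (forall z x, A z -> B ((z : H) + x *: w)) -> mu A = 1%E -> mu' B = 1%E.
Proof.
move=> Cmu.
pose X : {mfun (borel H * measurableTypeR R)%type >-> borel H} := add_scaled w.
exists (distribution (mu \x N)%E X); split.
  move=> a; have [v0 law] := Cmu a; rewrite ip0r in law *.
  have -> : ip (C a + ip w a *: w) a = ip (C a) a + ip w a ^+ 2.
    by rewrite ipDl ipZl expr2.
  split=> [|A mA]; first by rewrite addr_ge0// sqr_ge0.
  have mAX : measurable ((fun z : borel H => ip a z) @^-1` A).
    by rewrite -[X in measurable X]setTI; exact: measurable_ip.
  transitivity (\int[mu]_z N ((fun x => (ip a z + ip w a * x)%R) @^-1` A))%E.
    rewrite /pushforward /distribution /pushforward /= /product_measure1.
    apply: eq_integral => z _ /=; congr (normal_prob _ _ _).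
    apply/seteqP; split=> x /=; rewrite /xsection/= ?inE /= /preimage /=
      ipDr ipZr (ipC ip a w) mulrC//.
  have [b0|b0] := eqVneq (ip w a) 0.
    transitivity (\int[mu]_z (\1_((fun z : borel H => ip a z) @^-1` A) z)%:E)%E.
      apply: eq_integral => z _; rewrite b0 indicE.
      have [zA|zA] := boolP (z \in (fun z : borel H => ip a z) @^-1` A).
        rewrite (_ : _ @^-1` A = setT); first exact: (probability_setT N).
        apply/seteqP; split=> // x _ /=; rewrite mul0r addr0.
        by move: zA; rewrite inE.
      rewrite (_ : _ @^-1` A = set0); first exact: measure0.
      apply/seteqP; split=> // x /=; rewrite mul0r addr0 => zA'.
      by move/negP: zA; apply; rewrite inE.
    rewrite integral_indic// setIT b0 expr0n addr0; exact: law.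
  under eq_integral => z _ do rewrite normal_prob_affine//.
  have mip : measurable_fun [set: borel H] (fun z : borel H => ip a z : measurableTypeR R).
    exact: measurable_ip.
  pose aX : {mfun borel H >-> measurableTypeR R} :=
    HB.pack (fun z : borel H => ip a z : measurableTypeR R)
      (isMeasurableFun.Build _ _ _ _ _ mip).
  have nb : 0 < `|ip w a| by rewrite normr_gt0.
  have mh := measurable_normal_prob_mean nb mA.
  have h := @ge0_integral_distribution _ _ (borel H) (measurableTypeR R) R mu aX
    (fun u => normal_prob u `|ip w a| A) mh
    (fun u => measure_ge0 (normal_prob u `|ip w a|) A).
  apply: etrans (esym h) _.
  exact: (normal_lawD v0 mA b0 (nu := distribution mu aX)).
move=> A B mA mB AB muA.
have ABX : A `*` [set: measurableTypeR R] `<=` X @^-1` B.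
  by move=> [z x] [/= Az _]; exact: AB.
apply/eqP; rewrite eq_le probability_le1//=.
have <- : (mu \x N)%E (A `*` [set: measurableTypeR R]) = 1%E.
  by rewrite product_measure1E// [X in (X * _)%E]muA mul1e; exact: (probability_setT N).
apply: le_measure => //; rewrite inE; first exact: measurableX.
by rewrite -[X in measurable X]setTI; exact: measurable_add_scaled.
Qed.

Lemma continuous_proj (e : nat -> H) m : continuous (proj ip e m).
Proof.
move=> v; apply: cvg_big => [|i _]; first exact: add_continuous.
by apply: cvgZr_tmp; exact: ip_continuous.
Qed.

Lemma measurable_span (e : nat -> H) k :
  measurable ([set z | z = proj ip e k z] : set (borel H)).
Proof.
have cd : continuous (fun z : H => `|z - proj ip e k z|).
  move=> z; have h : z' - proj ip e k z' @[z' --> z] --> z - proj ip e k z.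
    by apply: cvgB; [exact: cvg_id|exact: continuous_proj].
  exact: (cvg_comp _ _ h (@norm_continuous _ _ _)).
have := borel_measurable_continuous cd measurableT (measurable_set1 0).
rewrite setTI; congr measurable; apply/seteqP; split=> z /=.
  by move/eqP; rewrite normr_eq0 subr_eq0 => /eqP.
by move=> {1}->; rewrite subrr normr0.
Qed.

(** A finite Karhunen-Loeve sum: independent terms [x_k *: (sqrt (tau k) *: e k)] are added one at a
    time to the point mass at 0, and the law stays on the span. *)
Lemma exists_gaussian (e : nat -> H) (tau : nat -> R) m :
  orthonormal_seq ip e -> (forall k, 0 <= tau k) ->
  exists mu : probability (borel H) R,
    gaussian ip 0 (fun v => \sum_(k < m) tau k *: tensor ip (e k) (e k) v) mu /\
    mu [set z | z = proj ip e m z] = 1%E.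
Proof.
move=> oe tau0.
have mS := measurable_span e.
elim: m => [|m [mu [gmu muS]]].
  exists (\d_(0 : borel H)); split.
    move=> a; rewrite big_ord0 ip0l ip0r; split=> // A mA.
    rewrite /normal_law eqxx /pushforward diracE.
    transitivity ((((0 : borel H) \in ((fun z : borel H => ip a z) @^-1` A))%:R)%:E : \bar R).
      exact: diracE.
    congr ((_ : bool)%:R%:E); apply/idP/idP; rewrite !inE /= ip0r//.
  transitivity ((((0 : borel H) \in [set z : borel H | z = proj ip e 0 z])%:R)%:E : \bar R).
    exact: diracE.
  by rewrite mem_set//= /proj big_ord0.
have [mu' [gmu' mu'S]] := gaussian_add (Num.sqrt (tau m) *: e m) gmu.
exists mu'; split.
  rewrite (_ : (fun v => _) = (fun v => \sum_(k < m) tau k *: tensor ip (e k) (e k) v +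
    ip (Num.sqrt (tau m) *: e m) v *: (Num.sqrt (tau m) *: e m)))//.
  apply/funext => v; rewrite big_ord_recr/=; congr (_ + _).
  by rewrite /tensor ipZl !scalerA mulrAC -expr2 sqr_sqrtr.
apply: (mu'S _ _ (mS m) (mS m.+1) _ muS) => z x /= zE.
rewrite /proj big_ord_recr/= -/(proj ip e m _).
have -> : ip (e m) ((z : H) + x *: (Num.sqrt (tau m) *: e m)) = x * Num.sqrt (tau m).
  by rewrite ipDr zE ip_proj// ltnn add0r !ipZr oe eqxx mulr1.
rewrite scalerA; congr (_ + _).
rewrite {1}zE; apply: eq_bigr => k _.
by rewrite ipDr !ipZr oe ltn_eqF ?mulr0 ?addr0.
Qed.

(** Both [y] and almost every [z] lie in the span, so the squared distance equals the sum of the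
    squared coordinates and nothing is lost against [gaussian_product]. *)
Lemma kernel_at_finite (e : nat -> H) (tau : nat -> R) m
    (mu : probability (borel H) R) (sigma : R) y :
  orthonormal_seq ip e -> (forall k, 0 <= tau k) -> 0 < sigma ->
  gaussian ip 0 (fun v => \sum_(k < m) tau k *: tensor ip (e k) (e k) v) mu ->
  mu [set z | z = proj ip e m z] = 1%E -> y = proj ip e m y ->
  kernel_at sigma mu y =
  \prod_(k < m) gauss_kernel sigma (tau k) (ip (e k) y).
Proof.
move=> oe tau0 s0 gmu muS yE.
set C := (fun v => _) in gmu.
have Cform u v : ip (C u) v = \sum_(k < m) tau k * (ip (e k) u * ip (e k) v).
  by rewrite /C ip_suml; apply: eq_bigr => k _; rewrite !ipZl.
have Clin a u v : C (a *: u + v) = a *: C u + C v.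
  rewrite /C scaler_sumr -big_split/=; apply: eq_bigr => k _.
  by rewrite /tensor ipDr ipZr !scalerA -scalerDl; congr (_ *: _); ring.
have Csym u v : ip (C u) v = ip (C v) u.
  by rewrite !Cform; apply: eq_bigr => k _; rewrite [X in _ * X]mulrC.
have Cee i j : (i < m)%N -> ip (C (e i)) (e j) = if i == j then tau i else 0.
  move=> im; rewrite Cform (bigD1 (Ordinal im))//= oe eqxx mul1r oe.
  rewrite big1 ?addr0.
    by case: eqP => _; rewrite ?mulr1 ?mulr0.
  move=> k ki; rewrite oe (_ : (val k == i) = false) ?mul0r ?mulr0//.
  by apply: contraNF ki => /eqP ki; apply/eqP/val_inj.
have eperp i j : (i < m)%N -> (j < m)%N -> i != j -> ip (C (e i)) (e j) = 0.
  by move=> im jm /negbTE ij; rewrite Cee// ij.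
have zperp i : (i < m)%N -> ip (C 0) (e i) = 0.
  by move=> _; rewrite Csym ip0r.
have := gaussian_product Hip Clin Csym gmu s0 (fun k => ip (e k) y) 0 eperp zperp.
rewrite cos0 mul1r ip0r oppr0 mul0r expR0 mulr1.
rewrite (eq_bigr (fun k : 'I_m => gauss_kernel sigma (tau k) (ip (e k) y))) => [<-|k _]; last first.
  by rewrite Cee// eqxx.
rewrite /kernel_at /Rintegral; congr fine.
have mprod : measurable_fun setT (fun z : borel H =>
    \prod_(k < m) expR (- sigma * (ip (e k) y - ip (e k) z) ^+ 2) * cos (0 + ip 0 z) : R).
  apply: measurable_funM.
    apply: measurable_prod => k _; apply: measurableT_comp => //.
    apply: measurable_funM => //; apply: measurable_funX; apply: measurable_funB => //.
    exact: measurable_ip.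
  rewrite (_ : (fun z : borel H => _) = cst 1)//.
  by apply/funext => z; rewrite ip0l addr0 cos0.
apply: ae_eq_integral => //.
- by apply/measurable_EFinP; exact: measurable_kernel.
- exact/measurable_EFinP.
have mS : measurable ([set z | z = proj ip e m z] : set (borel H)) by exact: measurable_span.
exists (~` [set z | z = proj ip e m z]); split.
- exact: measurableC.
- by have := probability_setC mu mS; rewrite muS subee.
move=> z /= nz zE; apply: nz => _; congr EFin.
rewrite ip0l addr0 cos0 mulr1 -expR_sum -mulr_sumr; congr (expR (_ * _)).
rewrite -Hip {1 2}yE {1 2}zE /proj -sumrB.
under eq_bigr do rewrite -scalerBl.
by rewrite (ip_comb_comb oe m (fun k => ip (e k) y - ip (e k) z)).
Qed.

End gaussian_construction.

(** * Optimality of the soft-thresholded covariance *)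

Section shrinkage.
Context (R : realType) (sigma : R).
Hypothesis sigma0 : 0 < sigma.
Implicit Types a c : R.

Definition dilation a := 1 + 2 * sigma * a.

(** [- ln (gauss_kernel sigma a t)] with [t ^ 2] replaced by its empirical mean [c]: the cost of
    modelling a direction of empirical variance [c] with variance [a]. *)
Definition objective c a := sigma * c / dilation a + ln (dilation a) / 2.

Definition shrink c := Num.max 0 (c - (2 * sigma)^-1).

Lemma shrink_ge0 c : 0 <= shrink c. Proof. by rewrite le_max lexx. Qed.

Lemma shrink_le c1 c2 : c1 <= c2 -> shrink c1 <= shrink c2.
Proof.
move=> c12; rewrite /shrink ge_max le_max lexx/= le_max lerB ?orbT//.
Qed.

Lemma shrink0 : shrink 0 = 0.
Proof. by apply/max_idPl; rewrite sub0r oppr_le0 invr_ge0 mulr_ge0// ltW. Qed.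

Lemma dilation_ge1 a : 0 <= a -> 1 <= dilation a.
Proof. by move=> a0; rewrite lerDl !mulr_ge0// ltW. Qed.

Lemma dilation_gt0 a : 0 <= a -> 0 < dilation a.
Proof. by move=> a0; rewrite (lt_le_trans ltr01)// dilation_ge1. Qed.

Lemma ln_dilation_ge0 a : 0 <= a -> 0 <= ln (dilation a).
Proof. by move=> a0; rewrite ln_ge0// dilation_ge1. Qed.

Lemma ln_dilation_eq0 a : 0 <= a -> ln (dilation a) = 0 -> a = 0.
Proof.
move=> a0 h; apply/eqP; move: h => /(congr1 expR).
rewrite lnK ?posrE ?dilation_gt0// expR0 /dilation => /eqP.
by rewrite -subr_eq0 addrC addKr mulf_eq0 mulf_eq0 pnatr_eq0/= gt_eqF.
Qed.

Lemma ln_lt_sub1 (x : R) : 0 < x -> x != 1 -> ln x < x - 1.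
Proof.
move=> x0 x1; have lx0 : ln x != 0.
  by apply: contra x1 => /eqP lx; rewrite -(lnK x0) lx expR0.
have := expR_gt1Dx lx0; rewrite lnK// => h; lra.
Qed.

(** The stationary point is [dilation a = 2 * sigma * c], clipped to [a >= 0]. The difference of
    objectives is the product in [key] plus [(m / D - 1 - ln (m / D)) / 2]. The second term is
    positive. The product is 0 without clipping, where [m = 2 * sigma * c]; with clipping, [m = 1]
    and neither factor is positive. *)
Lemma objective_shrink_lt c a : 0 <= c -> 0 <= a -> a != shrink c ->
  objective c (shrink c) < objective c a.
Proof.
move=> c0 a0 ac.
set D := dilation a; set m := dilation (shrink c).
have D0 : 0 < D by exact: dilation_gt0.
have m0 : 0 < m by exact: dilation_gt0 (shrink_ge0 c).
have s2 : 0 < 2 * sigma by rewrite mulr_gt0.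
have mD : m / D != 1.
  rewrite -(inj_eq (mulIf (lt0r_neq0 D0))) (divfK (lt0r_neq0 D0)) mul1r.
  by apply: contraNneq ac => /addrI /(mulfI (lt0r_neq0 s2)) ->.
have := ln_lt_sub1 (divr_gt0 m0 D0) mD.
rewrite ln_div ?posrE// => lnlt.
have key : 0 <= (sigma * c - m / 2) * (D^-1 - m^-1).
  rewrite /m /shrink; case: (leP 0 (c - (2 * sigma)^-1)) => hc.
    rewrite [X in X * _](_ : _ = 0) ?mul0r//.
    by rewrite /dilation; field; rewrite gt_eqF.
  rewrite /dilation mulr0 addr0 mulr_le0//.
    have : (c - (2 * sigma)^-1) * (2 * sigma) <= 0 by rewrite pmulr_lle0// ltW.
    by rewrite mulrBl mulVf ?gt_eqF//; lra.
  by rewrite invr1 subr_le0 invf_le1// dilation_ge1.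
rewrite -subr_gt0 /objective -/D -/m.
have -> : sigma * c / D + ln D / 2 - (sigma * c / m + ln m / 2) =
  (sigma * c - m / 2) * (D^-1 - m^-1) + (m / D - 1 - (ln m - ln D)) / 2.
  by field; rewrite !gt_eqF.
by rewrite ltr_wpDl// divr_gt0// subr_gt0.
Qed.

Lemma objective_shrink_le c a : 0 <= c -> 0 <= a ->
  objective c (shrink c) <= objective c a.
Proof.
move=> c0 a0; have [->//|ac] := eqVneq a (shrink c).
by rewrite ltW// objective_shrink_lt.
Qed.

Lemma ln_gauss_kernel a t : 0 <= a ->
  ln (gauss_kernel sigma a t) = - (sigma * t ^+ 2 / dilation a + ln (dilation a) / 2).
Proof.
move=> a0; have D0 := dilation_gt0 a0.
rewrite /gauss_kernel -/(dilation a) lnM ?posrE ?invr_gt0 ?sqrtr_gt0 ?expR_gt0//.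
rewrite expRK lnV ?posrE ?sqrtr_gt0//.
have -> : ln (Num.sqrt (dilation a)) = ln (dilation a) / 2.
  rewrite -{2}(sqr_sqrtr (ltW D0)) lnXn ?sqrtr_gt0// mulr2n.
  by field.
by rewrite opprD addrC !mulNr.
Qed.

Lemma gauss_kernel_gt0 a t : 0 <= a -> 0 < gauss_kernel sigma a t.
Proof.
by move=> a0; rewrite mulr_gt0 ?expR_gt0// invr_gt0 sqrtr_gt0 dilation_gt0.
Qed.

End shrinkage.

Lemma ln_prod (R : realType) n (f : 'I_n -> R) : (forall i, 0 < f i) ->
  ln (\prod_(i < n) f i) = \sum_(i < n) ln (f i).
Proof.
move=> f0; elim: n f f0 => [|n IH] f f0; first by rewrite !big_ord0 ln1.
by rewrite !big_ord_recr/= lnM ?posrE ?prodr_gt0// IH.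
Qed.

(** * The optimal value and a law attaining it *)

Section optimum.
Context (R : realType) (H : completeNormedModType R) (ip : {dot H for idfun}).
Hypothesis Hip : induces_norm ip.
Context (n : nat) (n0 : (0 < n)%N) (y : 'I_n -> H) (sigma : R).
Hypothesis sigma0 : 0 < sigma.
Variables (c : nat -> R) (e : nat -> H).
Hypothesis E : eigensystem ip (empirical_covariance ip y) c e.

Let oe := eigensystem_orthonormal E.
Let c0 := eigensystem_ge0 E.
Let cz := (empirical_eigensystem_data Hip n0 E).1.
Let yE := (empirical_eigensystem_data Hip n0 E).2.
Let nr : 0 < n%:R :> R. Proof. by rewrite ltr0n. Qed.

Local Notation tau k := (shrink sigma (c k)).
Local Notation D := (dilation sigma).
Local Notation obj := (objective sigma).

Lemma empirical_quadratic v :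
  \sum_(i < n) ip v (y i) ^+ 2 = n%:R * \sum_(k < n) c k * ip v (e k) ^+ 2.
Proof.
have Sv : ip (empirical_covariance ip y v) v = \sum_(k < n) c k * ip v (e k) ^+ 2.
  apply: cvg_unique (eigensystem_ip_cvg Hip E (u := v) (v := v)) _ => //.
  apply: cvg_near_cst; near=> m.
  have nm : (n <= m)%N by near: m; exact: nbhs_infty_ge.
  rewrite (big_ord_widen m (fun k => c k * ip v (e k) ^+ 2))// [RHS]big_mkcond/=.
  apply: eq_bigr => j _; case: ifPn => [jn|]; first by rewrite (ipC ip v) expr2.
  by rewrite -leqNgt => nj; rewrite cz// mul0r.
rewrite -Sv empirical_form mulrA divff ?gt_eqF// mul1r.
by apply: eq_bigr => i _; rewrite (ipC ip v) expr2.
Unshelve. all: end_near. Qed.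

(** The data lie in the span of [e_0, ..., e_(n-1)], so Parseval holds for them with these vectors
    alone. *)
Lemma empirical_trace : \sum_(i < n) ip (y i) (y i) = n%:R * \sum_(k < n) c k.
Proof.
transitivity (\sum_(i < n) \sum_(k < n) ip (e k) (y i) ^+ 2).
  by apply: eq_bigr => i _; rewrite {1 2}(yE i) /proj (ip_comb_comb oe n (fun k => ip (e k) (y i))).
rewrite exchange_big mulr_sumr; apply: eq_bigr => k _.
rewrite empirical_quadratic; congr (_ * _).
rewrite (bigD1 k)//= oe eqxx expr1n mulr1 big1 ?addr0// => j jk.
by rewrite oe (_ : (val k == val j) = false) ?expr0n ?mulr0//; apply/negbTE; rewrite eq_sym.
Qed.

(** The minimum of [- ln (kernel_mean sigma mu y) / n], as the two bounds below show. *)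
Definition optimum := \sum_(k < n) obj (c k) (tau k).

Lemma eigensystem_shrink (C : H -> H) :
  (forall v, C v = \sum_(k < n) tau k *: tensor ip (e k) (e k) v) ->
  eigensystem ip C (fun k => tau k) e.
Proof.
move=> CE; split=> // [k|i j ij|v]; first exact: shrink_ge0.
  by rewrite shrink_le// (eigensystem_le E).
apply: cvg_near_cst; near=> m.
have nm : (n <= m)%N by near: m; exact: nbhs_infty_ge.
rewrite /series/= big_mkord CE.
rewrite [RHS](big_ord_widen m (fun k => tau k *: tensor ip (e k) (e k) v))//.
rewrite [RHS]big_mkcond/=; apply: eq_bigr => j _; case: ifPn => //.
by rewrite -leqNgt => nj; rewrite cz// shrink0// scale0r.
Unshelve. all: end_near. Qed.

Lemma exists_optimal_gaussian : separable_space H ->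
  exists (C : H -> H) (mu : probability (borel H) R),
  [/\ eigensystem ip C (fun k => tau k) e, gaussian ip 0 C mu &
    ln (kernel_mean sigma mu y) = - (n%:R * optimum)].
Proof.
move=> Hsep.
have tau0 k : 0 <= tau k by exact: shrink_ge0.
have [mu [gmu muS]] := exists_gaussian Hip Hsep n oe tau0.
exists (fun v => \sum_(k < n) tau k *: tensor ip (e k) (e k) v), mu; split=> //.
  exact: eigensystem_shrink.
rewrite kernel_mean_prod// ln_prod; last by move=> i; exact: kernel_at_gt0.
have lnE i : ln (kernel_at sigma mu (y i)) =
    - \sum_(k < n) (sigma * ip (e k) (y i) ^+ 2 / D (tau k) + ln (D (tau k)) / 2).
  rewrite (kernel_at_finite Hip oe tau0 sigma0 gmu muS (yE i)) ln_prod; last first.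
    by move=> k; exact: gauss_kernel_gt0.
  by rewrite -sumrN; apply: eq_bigr => k _; rewrite ln_gauss_kernel.
rewrite (eq_bigr _ (fun i _ => lnE i)) sumrN; congr (- _).
rewrite exchange_big mulr_sumr; apply: eq_bigr => k _.
rewrite big_split/= sumr_const card_ord -[_ *+ n]mulr_natl -mulr_suml -mulr_sumr.
rewrite empirical_quadratic (bigD1 k)//= oe eqxx expr1n mulr1 big1 ?addr0.
  by rewrite /objective; ring.
move=> j jk; rewrite oe (_ : (val k == val j) = false) ?expr0n ?mulr0//.
by apply/negbTE; rewrite eq_sym.
Qed.

(** * Comparison with an arbitrary covariance *)

Section upper_bound.
Variables (C : H -> H) (lam : nat -> R) (psi : nat -> H).
Variable (mu : probability (borel H) R).
Hypothesis EC : eigensystem ip C lam psi.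
Hypothesis Cmu : gaussian ip 0 C mu.

Let lam0 := eigensystem_ge0 EC.
Let opsi := eigensystem_orthonormal EC.
Local Notation W j k := (ip (psi j) (e k) ^+ 2).

(** The squared distance from [e k] to the span of [psi_0, ..., psi_(m-1)]; its limit need not be 0,
    since [psi] may be incomplete. *)
Definition deficit k m := 1 - \sum_(j < m) W j k.

Lemma deficit_ge0 k m : 0 <= deficit k m.
Proof.
by rewrite subr_ge0 (le_trans (bessel Hip opsi m (e k)))// oe eqxx.
Qed.

Lemma deficit_le1 k m : deficit k m <= 1.
Proof. by rewrite gerBl sumr_ge0// => j _; exact: sqr_ge0. Qed.

Lemma sub_sumW_ge0 j : 0 <= 1 - \sum_(k < n) W j k.
Proof.
rewrite subr_ge0.
under eq_bigr do rewrite ipC.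
by rewrite (le_trans (bessel Hip oe n (psi j)))// opsi eqxx.
Qed.

(** [kernel_at_le] summed over the observations: the energies along [psi_j] become [c k]-weighted
    sums of [W j k], and by the trace identity the residual energies become the same sums of
    deficits. *)
Lemma ln_kernel_mean_le m :
  ln (kernel_mean sigma mu y) <=
  - (n%:R * (\sum_(j < m) (ln (D (lam j)) / 2 +
        sigma / D (lam j) * \sum_(k < n) c k * W j k) +
      sigma / D (lam m) * \sum_(k < n) c k * deficit k m)).
Proof.
rewrite kernel_mean_prod// ln_prod; last by move=> i; exact: kernel_at_gt0.
have bound i : ln (kernel_at sigma mu (y i)) <=
    - (\sum_(j < m) (sigma * ip (psi j) (y i) ^+ 2 / D (lam j) + ln (D (lam j)) / 2) +
      sigma * (ip (y i) (y i) - \sum_(j < m) ip (psi j) (y i) ^+ 2) / D (lam m)).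
  have kle := kernel_at_le Hip EC Cmu sigma0 m (y i).
  have P0 : 0 < \prod_(j < m) gauss_kernel sigma (lam j) (ip (psi j) (y i)).
    by apply: prodr_gt0 => j _; exact: gauss_kernel_gt0.
  have := ler_ln (kernel_at_gt0 mu (y i) sigma0) (mulr_gt0 P0 (expR_gt0 _)).
  move=> lnE; rewrite -lnE in kle; apply: (le_trans kle).
  rewrite lnM ?posrE ?expR_gt0// expRK ln_prod; last first.
    by move=> j; exact: gauss_kernel_gt0.
  rewrite opprD -[X in _ <= X + _]sumrN; apply: lerD; last by rewrite !mulNr.
  by apply: ler_sum => j _; rewrite ln_gauss_kernel.
apply: (le_trans (ler_sum _ (fun i _ => bound i))).
rewrite sumrN lerN2 mulrDr [leRHS]big_split/= le_eqVlt; apply/orP; left; apply/eqP.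
congr (_ + _).
  rewrite exchange_big mulr_sumr; apply: eq_bigr => j _.
  rewrite big_split/= sumr_const card_ord -[_ *+ n]mulr_natl -mulr_suml -mulr_sumr.
  by rewrite empirical_quadratic; ring.
rewrite -mulr_suml -mulr_sumr sumrB empirical_trace exchange_big/=.
under [X in _ = sigma * (_ - X) / _]eq_bigr do rewrite empirical_quadratic.
rewrite -mulr_sumr -mulrBr.
have -> : \sum_(k < n) c k * deficit k m =
    \sum_(k < n) c k - \sum_(j < m) \sum_(k < n) c k * W j k.
  rewrite exchange_big -sumrB; apply: eq_bigr => k _.
  by rewrite /deficit mulrBr mulr1 mulr_sumr.
by ring.
Qed.

(* The left-hand side is a sum of nonnegative terms, so an optimal [mu] makes each
   of them vanish in the limit. *)
Lemma optimality_gap m :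
  \sum_(j < m) ((1 - \sum_(k < n) W j k) * (ln (D (lam j)) / 2) +
    \sum_(k < n) W j k * (obj (c k) (lam j) - obj (c k) (tau k))) +
  \sum_(k < n) deficit k m * (obj (c k) (lam m) - obj (c k) (tau k)) <=
  - (n%:R^-1 * ln (kernel_mean sigma mu y)) - optimum + n%:R * (ln (D (lam m)) / 2).
Proof.
set l := ln (D (lam m)) / 2.
have l0 : 0 <= l by rewrite divr_ge0 ?ln_dilation_ge0.
have := ln_kernel_mean_le m.
set T := (X in - (_ * X)) => leT.
have {}leT : T <= - (n%:R^-1 * ln (kernel_mean sigma mu y)).
  by rewrite -mulrN ler_pdivlMl// lerNr.
(* The residual part of [T] lacks a logarithm. Adding [l] with weight [deficit k m] completes it to
   the objective at [lam m], at a cost of at most [n%:R * l]. *)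
have defl : \sum_(k < n) deficit k m * l <= n%:R * l.
  rewrite -mulr_suml ler_wpM2r//.
  rewrite -[leRHS](_ : \sum_(k < n) 1 = _); last by rewrite sumr_const card_ord.
  by apply: ler_sum => k _; exact: deficit_le1.
suff {leT} : \sum_(j < m) ((1 - \sum_(k < n) W j k) * (ln (D (lam j)) / 2) +
    \sum_(k < n) W j k * (obj (c k) (lam j) - obj (c k) (tau k))) +
  \sum_(k < n) deficit k m * (obj (c k) (lam m) - obj (c k) (tau k)) =
  T - optimum + \sum_(k < n) deficit k m * l by lra.
(* For each [k] the weights [W j k], [j < m], and [deficit k m] add up to 1, so the optimum can be
   spread over them. *)
have optE : optimum = \sum_(j < m) \sum_(k < n) W j k * obj (c k) (tau k) +
    \sum_(k < n) deficit k m * obj (c k) (tau k).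
  rewrite exchange_big -big_split/=; apply: eq_bigr => k _.
  by rewrite -mulr_suml -mulrDl /deficit addrC subrK mul1r.
have -> : T = \sum_(j < m) ((1 - \sum_(k < n) W j k) * (ln (D (lam j)) / 2) +
    \sum_(k < n) W j k * obj (c k) (lam j)) +
    \sum_(k < n) deficit k m * (obj (c k) (lam m) - l).
  congr (_ + _); last first.
    rewrite mulr_sumr; apply: eq_bigr => k _.
    by rewrite /objective -/l; ring.
  apply: eq_bigr => j _; rewrite mulrBl mul1r -addrA; congr (_ + _).
  rewrite mulr_suml -sumrN -big_split/= mulr_sumr; apply: eq_bigr => k _.
  by rewrite /objective; ring.
have -> : \sum_(j < m) ((1 - \sum_(k < n) W j k) * (ln (D (lam j)) / 2) +
      \sum_(k < n) W j k * (obj (c k) (lam j) - obj (c k) (tau k))) =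
    \sum_(j < m) ((1 - \sum_(k < n) W j k) * (ln (D (lam j)) / 2) +
      \sum_(k < n) W j k * obj (c k) (lam j)) -
    \sum_(j < m) \sum_(k < n) W j k * obj (c k) (tau k).
  rewrite -sumrB; apply: eq_bigr => j _; rewrite -addrA; congr (_ + _).
  by rewrite -sumrB; apply: eq_bigr => k _; rewrite mulrBr.
have -> : \sum_(k < n) deficit k m * (obj (c k) (lam m) - obj (c k) (tau k)) =
    \sum_(k < n) deficit k m * (obj (c k) (lam m) - l) +
    \sum_(k < n) deficit k m * l - \sum_(k < n) deficit k m * obj (c k) (tau k).
  by rewrite -big_split -sumrB /=; apply: eq_bigr => k _; ring.
by rewrite optE; ring.
Qed.

Let excess k a := obj (c k) a - obj (c k) (tau k).

Let excess_ge0 k a : 0 <= a -> 0 <= excess k a.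
Proof. by move=> a0; rewrite subr_ge0 objective_shrink_le. Qed.

(** The share of [psi j] in the gap. Its weight outside the span of the [e k] meets empirical
    variance 0, where the objective is [ln (D (lam j)) / 2] and the minimum is 0. *)
Let term j := (1 - \sum_(k < n) W j k) * (ln (D (lam j)) / 2) +
  \sum_(k < n) W j k * excess k (lam j).

Let term_ge0 j : 0 <= term j.
Proof.
rewrite addr_ge0//.
  by rewrite mulr_ge0 ?sub_sumW_ge0// divr_ge0 ?ln_dilation_ge0.
by apply: sumr_ge0 => k _; rewrite mulr_ge0 ?sqr_ge0 ?excess_ge0.
Qed.

Let rest m := \sum_(k < n) deficit k m * excess k (lam m).

Let rest_ge0 m : 0 <= rest m.
Proof.
by apply: sumr_ge0 => k _; rewrite mulr_ge0 ?deficit_ge0 ?excess_ge0.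
Qed.

Let ln_dilation_cvg0 : ln (D (lam m)) @[m --> \oo] --> (0 : R).
Proof.
have Dlam : D (lam m) @[m --> \oo] --> (1 : R).
  rewrite -[X in _ --> X]addr0 -[X in _ --> _ + X](mulr0 (2 * sigma)).
  apply: cvgD; first exact: cvg_cst.
  by apply: cvgM; [exact: cvg_cst|exact: (gaussian_eigenvalues_cvg0 Hip EC Cmu)].
rewrite -(@ln1 R).
exact: (cvg_comp _ _ Dlam (continuous_ln ltr01)).
Qed.

Let eps m := n%:R * (ln (D (lam m)) / 2).

Let eps_cvg0 : eps m @[m --> \oo] --> (0 : R).
Proof.
have h : n%:R * (ln (D (lam m)) / 2) @[m --> \oo] --> n%:R * (0 / 2 : R).
  by apply: cvgM; [exact: cvg_cst|apply: cvgM; [exact: ln_dilation_cvg0|exact: cvg_cst]].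
by rewrite mul0r mulr0 in h.
Qed.

Lemma ln_kernel_mean_le_optimum : ln (kernel_mean sigma mu y) <= - (n%:R * optimum).
Proof.
set X := - (n%:R^-1 * ln (kernel_mean sigma mu y)) - optimum.
have X0 : 0 <= X.
  have h : X + eps m @[m --> \oo] --> X + 0 by apply: cvgD; [exact: cvg_cst|exact: eps_cvg0].
  rewrite -[X in _ <= X]addr0; apply: (cvgr_to_ge h); near=> m.
  apply: le_trans (optimality_gap m); rewrite addr_ge0//; last exact: rest_ge0.
  by apply: sumr_ge0 => j _; exact: term_ge0.
move: X0; rewrite /X subr_ge0 -(ler_pM2l nr) mulrN mulrA divff ?gt_eqF// mul1r.
by rewrite lerNr.
Unshelve. all: end_near. Qed.

(** * The equality case *)

Section equality.
Hypothesis mu_optimal : - (n%:R * optimum) <= ln (kernel_mean sigma mu y).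

Let gap_eps m : \sum_(j < m) term j + rest m <= eps m.
Proof.
apply: (le_trans (optimality_gap m)); rewrite gerDr subr_le0.
by rewrite -mulrN ler_pdivrMl// lerNl.
Qed.

Let rest_eps m : rest m <= eps m.
Proof.
by apply: le_trans (gap_eps m); rewrite lerDr sumr_ge0// => j _; exact: term_ge0.
Qed.

(** [term j] does not depend on [m], yet it is at most [eps m] for every [m > j]. *)
Let term_eq0 j : term j = 0.
Proof.
apply/eqP; rewrite eq_le term_ge0 andbT.
apply: (cvgr_to_ge eps_cvg0); near=> m.
have jm : (j < m)%N by near: m; exact: nbhs_infty_gt.
apply: le_trans (gap_eps m); rewrite (bigD1 (Ordinal jm))//= -addrA lerDl.
by rewrite addr_ge0 ?rest_ge0// sumr_ge0// => i _; exact: term_ge0.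
Unshelve. all: end_near. Qed.

(** In a zero term every product [W j k * excess k (lam j)] is 0: either the vectors are orthogonal
    or [lam j] is the unique minimizer. *)
Let eigenvalue_shrink j k : (k < n)%N -> lam j * ip (psi j) (e k) = tau k * ip (psi j) (e k).
Proof.
move=> kn; have [->|W0] := eqVneq (ip (psi j) (e k)) 0; first by rewrite !mulr0.
congr (_ * _); apply/eqP; apply/negPn/negP => ne.
have := objective_shrink_lt sigma0 (c0 k) (lam0 j) ne.
rewrite -subr_gt0 -/(excess k (lam j)) => ex0.
have : 0 < term j.
  rewrite ltr_wpDl//.
    by rewrite mulr_ge0 ?sub_sumW_ge0// divr_ge0 ?ln_dilation_ge0.
  rewrite (bigD1 (Ordinal kn))//= ltr_pwDl//.
    by rewrite mulr_gt0// exprn_even_gt0.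
  by apply: sumr_ge0 => i _; rewrite mulr_ge0 ?sqr_ge0 ?excess_ge0.
by rewrite term_eq0 ltxx.
Qed.

(** A nonzero [lam j] makes the logarithmic cost positive, so its weight, the squared distance of
    [psi j] from the span, must be 0. *)
Let eigenvector_span j : lam j != 0 -> psi j = proj ip e n (psi j).
Proof.
move=> lj; apply/eqP; rewrite -subr_eq0 -(ip_eq0 Hip) (norm_sub_proj oe) opsi eqxx.
apply/negPn/negP => ne.
have h : 0 < 1 - \sum_(k < n) W j k.
  rewrite lt_neqAle sub_sumW_ge0 andbT eq_sym.
  by under eq_bigr do rewrite ipC.
have lnD : 0 < ln (D (lam j)).
  rewrite lt_neqAle eq_sym ln_dilation_ge0// andbT.
  by apply: contra lj => /eqP /(ln_dilation_eq0 sigma0 (lam0 j)) ->.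
have : 0 < term j.
  rewrite ltr_pwDl//; first by rewrite mulr_gt0// divr_gt0.
  by apply: sumr_ge0 => i _; rewrite mulr_ge0 ?sqr_ge0 ?excess_ge0.
by rewrite term_eq0 ltxx.
Qed.

(** As [lam m] tends to 0, the missing part of [e k] is charged [excess k 0] in the limit. This is
    positive when [tau k != 0], while the total charge is at most [eps m]. *)
Let deficit_cvg0 k : (k < n)%N -> tau k != 0 -> deficit k m @[m --> \oo] --> (0 : R).
Proof.
move=> kn tk.
have d0 : 0 < excess k 0.
  by rewrite subr_gt0 objective_shrink_lt// eq_sym.
have objc : obj (c k) (lam m) @[m --> \oo] --> obj (c k) 0.
  rewrite /objective /dilation mulr0 addr0 ln1.
  apply: cvgD; last by apply: cvgM; [exact: ln_dilation_cvg0|exact: cvg_cst].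
  apply: cvgM; first exact: cvg_cst.
  apply: cvgV; first exact: oner_neq0.
  rewrite -[X in _ --> X]addr0 -[X in _ --> _ + X](mulr0 (2 * sigma)).
  apply: cvgD; first exact: cvg_cst.
  by apply: cvgM; [exact: cvg_cst|exact: (gaussian_eigenvalues_cvg0 Hip EC Cmu)].
have up : (eps m + `|obj (c k) 0 - obj (c k) (lam m)|) / excess k 0 @[m --> \oo] --> (0 : R).
  have h : (eps m + `|obj (c k) 0 - obj (c k) (lam m)|) / excess k 0 @[m --> \oo] -->
      (0 + `|obj (c k) 0 - obj (c k) 0|) / excess k 0.
    apply: cvgM; last exact: cvg_cst.
    apply: cvgD; first exact: eps_cvg0.
    by apply: cvg_norm; apply: cvgB; [exact: cvg_cst|exact: objc].
  by rewrite subrr normr0 addr0 mul0r in h.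
apply: (squeeze_cvgr _ (cvg_cst 0) up); apply: nearW => m.
rewrite deficit_ge0/= ler_pdivlMr//.
have h1 : deficit k m * excess k (lam m) <= eps m.
  apply: le_trans (rest_eps m); rewrite /rest (bigD1 (Ordinal kn))//= lerDl.
  by apply: sumr_ge0 => i _; rewrite mulr_ge0 ?deficit_ge0 ?excess_ge0.
have -> : excess k 0 = excess k (lam m) + (obj (c k) 0 - obj (c k) (lam m)).
  by rewrite /excess; ring.
rewrite mulrDr lerD//; apply: (le_trans (ler_norm _)).
by rewrite normrM ger0_norm ?deficit_ge0// ler_piMl// deficit_le1.
Qed.

(** If [tau k = 0], every term of the series for [C (e k)] vanishes. Otherwise the expansion of
    [e k] along [psi] converges to [e k], and each of its coefficients is multiplied by [tau k]. *)
Let C_e k : (k < n)%N -> C (e k) = tau k *: e k.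
Proof.
move=> kn; have [tk|tk] := eqVneq (tau k) 0.
  rewrite tk scale0r; apply: (eigensystem_eq0 EC) => j.
  by rewrite eigenvalue_shrink// tk mul0r.
apply: cvg_unique (@eigensystem_cvg _ _ _ _ _ _ EC (e k)) _ => //.
have pe : proj ip psi m (e k) @[m --> \oo] --> e k.
  apply/cvgrPdist_le => /= eps' e0; near=> m.
  rewrite -(@ler_pXn2r _ 2)// ?nnegrE ?(ltW e0)// -Hip norm_sub_proj//.
  rewrite oe eqxx -/(deficit k m) -[leLHS]ger0_norm ?deficit_ge0// -[X in `|X|]opprK normrN -sub0r.
  near: m; have /cvgrPdist_le := deficit_cvg0 kn tk; apply.
  by rewrite exprn_gt0.
have h : tau k *: proj ip psi m (e k) @[m --> \oo] --> tau k *: e k.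
  by apply: cvgZl_tmp.
apply: (cvg_trans _ h); apply: near_eq_cvg; apply: nearW => m.
by rewrite scaler_sumr; apply: eq_bigr => j _; rewrite eigenvalue_shrink// scalerA.
Unshelve. all: end_near. Qed.

(** [C_e] gives [C] on the span of the [e k]; on the orthogonal complement [C] is 0, since every
    [psi j] with nonzero eigenvalue lies in the span. *)
Lemma optimal_covariance : eigensystem ip C (fun k => tau k) e.
Proof.
apply: eigensystem_shrink => v.
have Clin := eigensystem_linear EC.
have C0 : C 0 = 0 by apply: (eigensystem_eq0 EC) => j; rewrite ip0r mulr0.
have Csum m (a : nat -> R) : C (\sum_(k < m) a k *: e k) = \sum_(k < m) a k *: C (e k).
  elim: m => [|m IH]; first by rewrite !big_ord0.
  by rewrite !big_ord_recr/= [X in C X]addrC Clin IH addrC.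
have Cperp : C (v - proj ip e n v) = 0.
  apply: (eigensystem_eq0 EC) => j.
  have [->|lj] := eqVneq (lam j) 0; first by rewrite mul0r.
  by rewrite (eigenvector_span lj) ip_proj_sub_proj// mulr0.
have := Clin 1 (v - proj ip e n v) (proj ip e n v).
rewrite !scale1r subrK Cperp add0r => ->.
rewrite (Csum n (fun k => ip (e k) v)); apply: eq_bigr => k _.
by rewrite C_e// /tensor !scalerA mulrC.
Qed.

End equality.
End upper_bound.
End optimum.

(** * The limit of large [sigma] *)

Lemma shrink_cvg (R : realType) (c : R) : 0 <= c ->
  shrink sigma c @[sigma --> +oo] --> c.
Proof.
move=> c0; apply/cvgrPdist_le => /= eps eps0; near=> sigma.
have s0 : 0 < sigma by near: sigma; exact: nbhs_pinfty_gt.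
have inv0 : 0 < (2 * sigma)^-1 by rewrite invr_gt0 mulr_gt0.
have inv_eps : (2 * sigma)^-1 <= eps.
  rewrite -[leRHS]invrK lef_pV2 ?posrE ?mulr_gt0 ?invr_gt0//.
  by rewrite mulrC -ler_pdivrMr//; near: sigma; exact: nbhs_pinfty_ge.
rewrite /shrink; case: (leP 0 (c - (2 * sigma)^-1)) => h.
  by rewrite opprB addrC subrK gtr0_norm.
by rewrite subr0 ger0_norm//; lra.
Unshelve. all: end_near. Qed.

Unset Implicit Arguments.
Set Strict Implicit.
Set Printing Implicit Defensive.

Theorem proposition9 (R : realType) (H : completeNormedModType R)
    (ip : {dot H for idfun})
    (H_hilbert : induces_norm ip)
    (H_separable : separable_space H)
    (H_infinite : infinite_dimensional H)
    (C : H -> H) (lambda : nat -> R) (psi : nat -> H)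
    (C_eigen : eigensystem ip C lambda psi)
    (d : measure_display) (Omega : measurableType d) (P : probability Omega R)
    (n : nat) (n_gt0 : (0 < n)%N)
    (Y : 'I_n -> {RV P >-> borel H})
    (Y_gaussian : forall i : 'I_n, gaussian ip 0 C (distribution P (Y i)))
    (Y_independent : independent_elements Y)
    (omega : Omega) (y : 'I_n -> H)
    (y_realization : forall i : 'I_n, y i = Y i omega) :
  (forall sigma : R, 0 < sigma ->
     exists (lam : nat -> R) (phi : nat -> H), is_mkm ip sigma y lam phi)
  /\
  (forall (lam : R -> nat -> R) (phi : R -> nat -> H),
     (forall sigma : R, 0 < sigma -> is_mkm ip sigma y (lam sigma) (phi sigma)) ->
   forall (mu_hat : nat -> R) (psi_hat : nat -> H),
     eigensystem ip (empirical_covariance ip y) mu_hat psi_hat ->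
     (forall k : nat,
        lam sigma k @[sigma --> +oo] -->
          n%:R^-1 * \sum_(i < n) ip (y i) (psi_hat k) ^+ 2) /\
     exists phi' : R -> nat -> H,
       (forall sigma : R, 0 < sigma ->
          same_operator ip (lam sigma) (phi sigma) (phi' sigma)) /\
       (forall k : nat, phi' sigma k @[sigma --> +oo] --> psi_hat k)).
Proof.
split=> [sigma sigma0|lam phi mkm mu_hat psi_hat E].
  have [c [e E]] := exists_empirical_eigensystem H_hilbert H_infinite n_gt0 y.
  have [C' [mu [EC' Cmu lnE]]] :=
    exists_optimal_gaussian H_hilbert n_gt0 sigma0 E H_separable.
  exists (fun k => shrink sigma (c k)), e, C', mu; split=> // lam psi' C'' mu' E' Cmu'.
  by rewrite lnE; exact: (ln_kernel_mean_le_optimum H_hilbert n_gt0 sigma0 E E' Cmu').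
(* The explicit optimal law is one of the competitors, so an MKM law reaches the optimal value and
   the equality case identifies its covariance. *)
have opt (sigma : R) : 0 < sigma -> exists C' : H -> H,
    eigensystem ip C' (lam sigma) (phi sigma) /\
    eigensystem ip C' (fun k => shrink sigma (mu_hat k)) psi_hat.
  move=> sigma0; have [C' [mu [EC' Cmu best]]] := mkm sigma sigma0.
  exists C'; split=> //.
  apply: (optimal_covariance H_hilbert n_gt0 sigma0 E EC' Cmu).
  have [C'' [mu' [EC'' Cmu' <-]]] :=
    exists_optimal_gaussian H_hilbert n_gt0 sigma0 E H_separable.
  exact: best EC'' Cmu'.
have lamE (sigma : R) k : 0 < sigma -> lam sigma k = shrink sigma (mu_hat k).
  move=> /opt[C' [E1 E2]].
  exact: (eigensystem_values_uniq H_hilbert k E1 E2).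
split=> [k|].
  (* The stated limit is the Rayleigh quotient of the empirical covariance at [psi_hat k], that is,
     its eigenvalue. *)
  have -> : n%:R^-1 * \sum_(i < n) ip (y i) (psi_hat k) ^+ 2 = mu_hat k.
    under eq_bigr do rewrite expr2.
    rewrite -empirical_form (eigensystem_psi E) ipZl.
    by rewrite (eigensystem_orthonormal E) eqxx mulr1.
  have := @shrink_cvg _ _ (eigensystem_ge0 E k).
  apply: cvg_trans; apply: near_eq_cvg; near=> sigma; apply/esym/lamE.
  by near: sigma; exact: nbhs_pinfty_gt.
(* [phi sigma] itself may change sign or basis with [sigma]; [psi_hat] diagonalizes the same MKM
   covariance for every [sigma], so the constant family will do. *)
exists (fun=> psi_hat); split=> [sigma sigma0|k]; last exact: cvg_cst.
have [C' [E1 E2]] := opt sigma sigma0; exists C'; split=> //.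
by rewrite (_ : lam sigma = (fun k => shrink sigma (mu_hat k)))//; apply/funext => k; exact: lamE.
Unshelve. all: end_near. Qed.
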